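(* For every integer $n\ge 2$ the $(n+7)$-point quadrature formula $$Q_{n+7}[f]=-\frac{1}{9n}\sigma(0)+\frac{1}{n}\sigma\Big(\frac1{4n}\Big)-\frac{1}{2n}\sigma\Big(\frac1{2n}\Big)+\frac{1}{9n}\sigma\Big(\frac3{4n}\Big)+\frac1n\sum_{k=1}^{n-1}f\Big(\frac kn\Big),\qquad \sigma(x):=f(x)+f(1-x),$$ is positive definite of order $4$, with error constant $$c_4(Q_{n+7})=\frac{1}{720\,n^4}\Big(1-\frac{15}{32\,n}\Big),$$ and the sequence $\{Q_{n+7}\}$ is asymptotically optimal positive definite of order $4$, i.e. $\lim_{n\to\infty}c_4(Q_{n+7})/c^{+}_{n+7,4}=1$.
   Context: An $N$-point quadrature formula is a functional $Q[f]=\sum_{i=1}^{N}a_i f(\tau_i)$ with nodes $0\le\tau_1<\dots<\tau_N\le 1$ and real weights; its remainder is $R[Q;f]=\int_0^1 f(x)\,dx-Q[f]$. $Q$ is positive definite of order $4$, with error constant $c_4(Q)$, if there is a constant $c_4(Q)>0$ such that for every $f\in C^4[0,1]$ there is $\xi\in[0,1]$ with $R[Q;f]=c_4(Q)f^{(4)}(\xi)$. $c^{+}_{N,4}$ denotes the infimum of $c_4(Q)$ over all $N$-point positive definite quadrature formulae $Q$ of order $4$. *)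

(* Defs.v *)
From Stdlib Require Import Reals.
From Coquelicot Require Import Coquelicot.
Open Scope R_scope.

Definition I01 (x : R) : Prop := 0 <= x <= 1.

(* Functions on [0,1] are represented by total functions R -> R whose values
   outside [0,1] are irrelevant: derivatives and continuity are taken within
   [0,1], hence are one-sided at the endpoints. *)
Fixpoint is_derive_n_01 (k : nat) (f g : R -> R) : Prop :=
  match k with
  | O => forall x, I01 x -> g x = f x
  | S k' => exists h : R -> R,
      (forall x, I01 x -> D_in f h I01 x) /\ is_derive_n_01 k' h g
  end.

(* f is in C^4[0,1] and g is its fourth derivative there. *)
Definition C4_01 (f g : R -> R) : Prop :=
  is_derive_n_01 4 f g /\ (forall x, I01 x -> continue_in g I01 x).

Definition is_quadrature (N : nat) (Q : (R -> R) -> R) : Prop :=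
  exists tau a : nat -> R,
    (forall i, (1 <= i <= N)%nat -> 0 <= tau i <= 1) /\
    (forall i j, (1 <= i)%nat -> (i < j)%nat -> (j <= N)%nat -> tau i < tau j) /\
    (forall f : R -> R, Q f = sum_n_m (fun i => a i * f (tau i)) 1 N).

Definition remainder (Q : (R -> R) -> R) (f : R -> R) : R := RInt f 0 1 - Q f.

Definition is_error_constant4 (Q : (R -> R) -> R) (c : R) : Prop :=
  0 < c /\
  forall f f4 : R -> R, C4_01 f f4 ->
    exists xi : R, 0 <= xi <= 1 /\ remainder Q f = c * f4 xi.

Definition positive_definite4 (Q : (R -> R) -> R) : Prop :=
  exists c : R, is_error_constant4 Q c.

(* The error constant is unique when it exists (test on x ^ 4); c4 is only
   meaningful for positive definite Q. *)
Definition c4 (Q : (R -> R) -> R) : R := iota (is_error_constant4 Q).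

(* The set is bounded below by 0, so the infimum is finite as soon as an N-point
   positive definite formula exists; [real] maps the infimum +oo of the empty
   set to 0. *)
Definition c4_plus (N : nat) : R :=
  real (Glb_Rbar (fun c => exists Q : (R -> R) -> R,
    is_quadrature N Q /\ positive_definite4 Q /\ c = c4 Q)).

Definition sigma (f : R -> R) (x : R) : R := f x + f (1 - x).

(* The (n+7)-point formula, for n >= 2. *)
Definition Qform (n : nat) (f : R -> R) : R :=
  - (1 / (9 * INR n)) * sigma f 0
  + 1 / INR n * sigma f (1 / (4 * INR n))
  - 1 / (2 * INR n) * sigma f (1 / (2 * INR n))
  + 1 / (9 * INR n) * sigma f (3 / (4 * INR n))
  + 1 / INR n * sum_n_m (fun k => f (INR k / INR n)) 1 (n - 1).

(* Main.v *)
Require Import Defs.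
From Stdlib Require Import Reals Lra Lia Psatz ClassicalEpsilon.
From Coquelicot Require Import Coquelicot.
Open Scope R_scope.

(** Definiteness of [Qform n]: the Peano kernel [K] of order 4 is, on each of the
    [n - 2] inner mesh cells, the nonnegative quartic [(x-a)^2 (x-b)^2 / 24], and
    on the two end cells an explicit nonnegative quartic spline with knots at the
    quarter points; four integrations by parts on each piece write the remainder
    as the integral of [K] times the fourth derivative.

    Optimality: the kernel [K] of an arbitrary positive definite formula with [N]
    nodes is a nonnegative [C^2] piecewise quartic.  Cut [[0,1]] at the nodes into
    [N + 1] cells.  With [u], [v] the values of [K], [K'] at the ends of a cell of
    length [h], the corrected trapezoidal rule gives exactly
      [int K = h/2 (u0+u1) + h^2/12 (v0-v1) + h^5/720].
    After rescaling the mean length to 1, there is a potential [phi] with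
      [int K >= (5h-4)/720 + phi v0 - phi v1]
    on every cell (a Bellman inequality, [4/720] being the price of a node).  As
    [K' = 0] at 0 and 1, the sum telescopes to [c4 >= 1 / (720 (N+1)^4)], and
    [(n+8)^4 / n^4] tends to 1. *)

(** * Inequality on a single cell *)

Ltac nonneg :=
  repeat first [ assumption | apply Rplus_le_le_0_compat | apply Rmult_le_pos
               | apply pow_le | lra ].

Ltac poly_nonneg :=
  match goal with |- 0 <= ?e => field_simplify e end; unfold Rdiv; nonneg.

(* Coquelicot states sums over R with equality at the carrier of a structure, which [ring] rejects. *)
Ltac eq_R := match goal with |- ?x = ?y => change (@eq R x y) end.

(* The gain of a cell of length k over the tangent line of k^5 / 720 at k = 1. *)
Definition slack (k : R) : R := (k ^ 5 - 5 * k + 4) / 720.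

Lemma slack_nonneg k : 0 <= k -> 0 <= slack k.
Proof.
intros Hk; unfold slack.
replace (k ^ 5 - 5 * k + 4) with ((k - 1) ^ 2 * (k ^ 3 + 2 * k ^ 2 + 3 * k + 4)) by ring.
unfold Rdiv; apply Rmult_le_pos; [|lra].
apply Rmult_le_pos; [apply pow2_ge_0|nonneg].
Qed.

(* With m the weighted mean (2 h + k) / 3, the right-hand side is
   720 (slack h + slack k / 2 - 3/2 slack m): it no longer depends on the scale. *)
Lemma two_gap_poly h k : 0 <= k -> k <= h ->
  5 / 8 * (h * (h ^ 2 - k ^ 2) ^ 2)
  <= h ^ 5 + k ^ 5 / 2 - 3 / 2 * ((2 * h + k) / 3) ^ 5.
Proof.
intros Hk Hkh; pose (d := h - k).
assert (Hd : 0 <= d) by (unfold d; lra).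
replace h with (k + d) by (unfold d; ring); clearbody d; clear Hkh.
apply Rminus_le_0; poly_nonneg.
Qed.

(** With m = (2 h + k + c) / 4, the first summand is 720 h (slack h + slack k / 2 + slack c / 2 - 2
    slack m): constants and linear terms cancel, which leaves a form of degree 6. The rest is 720 /
    288 times the numerator in [slack_three]. *)
Definition three_gap (h k c : R) : R :=
  h * (h ^ 5 + k ^ 5 / 2 + c ^ 5 / 2 - 2 * ((2 * h + k + c) / 4) ^ 5)
  - 5 / 2 * (h ^ 2 * (h ^ 2 - k ^ 2) ^ 2 / 4 + h ^ 2 * (h ^ 2 - k ^ 2) * (h ^ 2 - c ^ 2) / 12
             - (h ^ 2 - k ^ 2) ^ 2 * (c ^ 2 - k ^ 2) / 48).

(* Polya: after multiplication by (x + y + z)^4 all coefficients are nonnegative. *)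
Lemma three_gap_cone1 x y z : 0 <= x -> 0 <= y -> 0 <= z ->
  0 <= (x + y + z) ^ 4 * three_gap (x + y + z) z (y / 2 + z).
Proof. intros Hx Hy Hz; unfold three_gap; poly_nonneg. Qed.

Lemma three_gap_cone2 x y z : 0 <= x -> 0 <= y -> 0 <= z ->
  0 <= (x + y + z) ^ 4 * three_gap (x + y + z) z (x / 2 + y + z).
Proof. intros Hx Hy Hz; unfold three_gap; poly_nonneg. Qed.

(** The range k <= c <= h is cut along 2 c = h + k into two simplicial cones with coordinates x, y,
    z >= 0. *)
Lemma three_gap_nonneg h k c : 0 < h -> 0 <= k -> k <= c -> c <= h -> 0 <= three_gap h k c.
Proof.
intros Hh Hk Hkc Hch.
apply Rmult_le_reg_l with (h ^ 4); [now apply pow_lt|rewrite Rmult_0_r].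
destruct (Rle_dec (2 * c) (h + k)) as [Hc|Hc].
- generalize (three_gap_cone1 (h + k - 2 * c) (2 * (c - k)) k).
  replace (h + k - 2 * c + 2 * (c - k) + k) with h by ring.
  replace (2 * (c - k) / 2 + k) with c by field.
  intros H; apply H; lra.
- generalize (three_gap_cone2 (2 * (h - c)) (2 * c - h - k) k).
  replace (2 * (h - c) + (2 * c - h - k) + k) with h by ring.
  replace (2 * (h - c) / 2 + (2 * c - h - k) + k) with c by field.
  intros H; apply H; lra.
Qed.

(** The constant 1/1152 is 5/8 of 1/720, and also the product 1/2 * 1/24 * 1/24 that arises from h /
    2 times [piece_single]. *)
Lemma slack_two h k : 0 < h -> 0 <= k -> k <= h ->
  h * (h ^ 2 - k ^ 2) ^ 2 / 1152 <= slack h + slack k / 2.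
Proof.
intros Hh Hk Hkh.
pose proof (two_gap_poly h k Hk Hkh) as H.
assert (H' : 0 <= slack ((2 * h + k) / 3)) by (apply slack_nonneg; lra).
unfold slack in *; lra.
Qed.

(** The slack kept at the mean pays for the outgoing [psi] in [slope_bound]. *)
Lemma slack_two_mean h k : 0 < h -> 0 <= k -> k <= h ->
  h * (h ^ 2 - k ^ 2) ^ 2 / 1152 + slack ((2 * h + k) / 3) / 2 <= slack h + slack k / 2.
Proof.
intros Hh Hk Hkh.
pose proof (two_gap_poly h k Hk Hkh) as H.
assert (H' : 0 <= slack ((2 * h + k) / 3)) by (apply slack_nonneg; lra).
unfold slack in *; lra.
Qed.

Lemma slack_three h k c : 0 < h -> 0 <= k -> k <= c -> c <= h ->
  (h ^ 2 * (h ^ 2 - k ^ 2) ^ 2 / 4 + h ^ 2 * (h ^ 2 - k ^ 2) * (h ^ 2 - c ^ 2) / 12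
   - (h ^ 2 - k ^ 2) ^ 2 * (c ^ 2 - k ^ 2) / 48) / 288
  <= h * (slack h + slack k / 2 + slack c / 2).
Proof.
intros Hh Hk Hkc Hch.
pose proof (three_gap_nonneg h k c Hh Hk Hkc Hch) as H.
assert (H' : 0 <= h * slack ((2 * h + k + c) / 4)).
{ apply Rmult_le_pos; [lra|apply slack_nonneg; lra]. }
unfold slack, three_gap in *; lra.
Qed.

(** * The potential of the Bellman inequality *)

Lemma psi_min_exists v : exists k, 0 <= k <= 1 /\
  forall k', 0 <= k' <= 1 ->
    k ^ 2 * v / 12 + slack k / 2 <= k' ^ 2 * v / 12 + slack k' / 2.
Proof.
destruct (continuity_ab_min (fun k => k ^ 2 * v / 12 + slack k / 2) 0 1) as [k [Hk Hk']].
- lra.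
- intros c _; apply derivable_continuous_pt; unfold slack.
  apply ex_derive_Reals_0; auto_derive; trivial.
- exists k; split; auto.
Qed.

(* psi is the worst case over the length k <= 1 of the neighbouring cell: a cell
   pays psi to the neighbour on which positivity of K does not control the slope. *)
Definition psi_arg v := proj1_sig (constructive_indefinite_description _ (psi_min_exists v)).
Definition psi v := psi_arg v ^ 2 * v / 12 + slack (psi_arg v) / 2.

Lemma psi_attained v : exists k, 0 <= k <= 1 /\ psi v = k ^ 2 * v / 12 + slack k / 2.
Proof.
exists (psi_arg v); split; [|reflexivity].
unfold psi_arg; destruct constructive_indefinite_description; simpl; tauto.
Qed.

Lemma psi_le v k : 0 <= k <= 1 -> psi v <= k ^ 2 * v / 12 + slack k / 2.
Proof.
unfold psi, psi_arg; destruct constructive_indefinite_description as [k0 [H0 H1]]; simpl.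
apply H1.
Qed.

Lemma psi_0 : psi 0 = 0.
Proof.
apply Rle_antisym.
- replace 0 with (1 ^ 2 * 0 / 12 + slack 1 / 2) at 2 by (unfold slack; field).
  apply psi_le; lra.
- destruct (psi_attained 0) as [k [Hk ->]].
  pose proof (slack_nonneg k); lra.
Qed.

(** Oddness matches the reflection of a cell, which turns the slopes (v0, v1) into (- v1, - v0) and
    so preserves phi v0 - phi v1. *)
Definition phi v := if Rle_dec 0 v then psi v else - psi (- v).

Lemma phi_pos v : 0 <= v -> phi v = psi v.
Proof. intros Hv; unfold phi; destruct Rle_dec; tauto. Qed.

Lemma phi_opp v : phi (- v) = - phi v.
Proof.
unfold phi; destruct (Rle_dec 0 (- v)); destruct (Rle_dec 0 v); try lra.
- replace v with 0 by lra; rewrite Ropp_0, psi_0; ring.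
- rewrite Ropp_involutive; ring.
Qed.

(* Hermite form of the kernel on a cell, t in [0,1] being the relative position. *)
Definition piece (h u0 u1 v0 v1 t : R) : R :=
  h ^ 4 / 24 * (t ^ 2 * (1 - t) ^ 2) + u0 * ((1 - t) ^ 2 * (1 + 2 * t))
  + u1 * (t ^ 2 * (3 - 2 * t)) + h * v0 * (t * (1 - t) ^ 2) - h * v1 * (t ^ 2 * (1 - t)).

(* Positivity at the single point t = eta / 4. *)
Lemma piece_single h u0 u1 v0 v1 eta :
  0 <= u0 -> 0 <= u1 -> 0 <= eta <= 1 ->
  (forall t, 0 <= t <= 1 -> 0 <= piece h u0 u1 v0 v1 t) ->
  0 <= u0 + u1 + h ^ 4 / 24 * (eta ^ 2 / 24)
       + eta / 6 * (h * v0) - eta / 6 * (eta / (4 - eta)) * (h * v1).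
Proof.
intros Hu0 Hu1 He Hp.
pose (s := eta / 4).
assert (Hs : 0 <= s <= 1 / 4) by (unfold s; lra).
assert (H := Hp s ltac:(lra)).
replace eta with (4 * s) by (unfold s; field); clearbody s.
(* This factor turns the quartic and slope terms into those of [piece] at s; the surplus
   coefficients of u0 and u1 are nonnegative as s <= 1/4. *)
apply Rmult_le_reg_l with (3 / 2 * (1 - s) ^ 2); [apply Rmult_lt_0_compat; [lra|apply pow_lt; lra]|].
rewrite Rmult_0_r.
replace (3 / 2 * (1 - s) ^ 2 * _) with
  (piece h u0 u1 v0 v1 s + u0 * ((1 - s) ^ 2 * (1 / 2 - 2 * s))
   + u1 * (3 / 2 * (1 - s) ^ 2 - s ^ 2 * (3 - 2 * s))).
- apply Rplus_le_le_0_compat; [apply Rplus_le_le_0_compat; [exact H|]|].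
  + apply Rmult_le_pos; [lra|apply Rmult_le_pos; [apply pow2_ge_0|lra]].
  + apply Rmult_le_pos; [lra|nra].
- unfold piece; field; lra.
Qed.

(* Positivity at the two points with t (1 - t) = eta / 6. *)
Lemma piece_sym h u0 u1 v0 v1 eta :
  0 <= eta <= 1 ->
  (forall t, 0 <= t <= 1 -> 0 <= piece h u0 u1 v0 v1 t) ->
  0 <= u0 + u1 + h ^ 4 / 24 * (eta ^ 2 / 18) + eta / 6 * (h * v0) - eta / 6 * (h * v1).
Proof.
intros He Hp.
pose (d := sqrt (1 - 2 / 3 * eta)).
assert (Hd0 : 0 <= d) by apply sqrt_pos.
assert (Hd : d * d = 1 - 2 / 3 * eta) by (apply sqrt_sqrt; lra).
assert (Hd1 : d <= 1) by nra.
assert (H1 := Hp ((1 - d) / 2) ltac:(lra)).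
assert (H2 := Hp ((1 + d) / 2) ltac:(lra)).
replace eta with (3 / 2 * (1 - d ^ 2)) by lra.
unfold piece in *; lra.
Qed.

Lemma piece_mirror h u0 u1 v0 v1 t :
  piece h u1 u0 (- v1) (- v0) (1 - t) = piece h u0 u1 v0 v1 t.
Proof. unfold piece; ring. Qed.

Lemma gap_ratio h k : 0 < h -> 0 <= k -> k <= h ->
  0 <= 1 - k ^ 2 / h ^ 2 <= 1 /\ h ^ 2 * (1 - k ^ 2 / h ^ 2) = h ^ 2 - k ^ 2.
Proof.
intros Hh Hk Hkh.
assert (Hh2 : 0 < h ^ 2) by now apply pow_lt.
split; [|field; lra].
assert (0 <= k ^ 2 / h ^ 2) by (apply Rdiv_le_0_compat; nra).
assert (k ^ 2 / h ^ 2 <= 1) by (apply Rle_div_l; nra).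
lra.
Qed.

(** In a valley both slopes cost, and positivity inside the cell must limit them. With h^2 eta = h^2
    - k^2, h / 2 times [piece_single] reproduces the v0 terms exactly, and [slack_two] covers its
    constant. Where this is too weak for v1, [piece_sym] is mixed in and [slack_three] pays. *)
Lemma valley_bound_ordered h u0 u1 v0 v1 k c :
  0 < h -> 0 <= u0 -> 0 <= u1 -> v0 <= 0 -> 0 <= v1 -> 0 <= k -> k <= c ->
  (forall t, 0 <= t <= 1 -> 0 <= piece h u0 u1 v0 v1 t) ->
  0 <= h / 2 * (u0 + u1) + h ^ 2 / 12 * (v0 - v1) + slack h
       - k ^ 2 * v0 / 12 + slack k / 2 + c ^ 2 * v1 / 12 + slack c / 2.
Proof.
intros Hh Hu0 Hu1 Hv0 Hv1 Hk Hkc Hp.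
pose proof (slack_nonneg h ltac:(lra)) as Sh.
pose proof (slack_nonneg k ltac:(lra)) as Sk.
pose proof (slack_nonneg c ltac:(lra)) as Sc.
destruct (Rle_dec k h) as [Hkh|Hkh].
2:{ assert (0 <= h * (u0 + u1)) by nra.
    assert (0 <= (k ^ 2 - h ^ 2) * - v0) by (apply Rmult_le_pos; nra).
    assert (0 <= (c ^ 2 - h ^ 2) * v1) by (apply Rmult_le_pos; nra).
    lra. }
destruct (gap_ratio h k Hh Hk Hkh) as [He Heq].
set (eta := 1 - k ^ 2 / h ^ 2) in *.
pose proof (piece_single h u0 u1 v0 v1 eta Hu0 Hu1 He Hp) as HS.
pose proof (slack_two h k Hh Hk Hkh) as S2.
assert (Hh2 : 0 < h ^ 2) by now apply pow_lt.
assert (Hkappa : eta / 4 <= eta / (4 - eta)).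
{ apply Rmult_le_reg_r with (4 * (4 - eta)); [lra|].
  replace (eta / 4 * (4 * (4 - eta))) with (eta * (4 - eta)) by field.
  replace (eta / (4 - eta) * (4 * (4 - eta))) with (4 * eta) by (field; lra).
  nra. }
assert (Hhv1 : 0 <= h * v1) by nra.
assert (HS' : 0 <= u0 + u1 + h ^ 4 / 24 * (eta ^ 2 / 24)
       + eta / 6 * (h * v0) - eta ^ 2 / 24 * (h * v1)).
{ assert (0 <= (eta / (4 - eta) - eta / 4) * (eta * (h * v1))); [|nra].
  apply Rmult_le_pos; [lra|]; apply Rmult_le_pos; lra. }
clear HS Hkappa.
assert (Hcost : h * (h ^ 2 - k ^ 2) ^ 2 = h ^ 5 * eta ^ 2) by (rewrite <- Heq; ring).
(* [piece_single] suffices when (h^2 - c^2) / 12 is at most its coefficient h^2 eta^2 / 48 of v1. *)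
destruct (Rle_dec (h ^ 2 - c ^ 2) (h ^ 2 * (eta ^ 2 / 4))) as [Hc|Hc].
{ assert (0 <= h / 2 * (u0 + u1 + h ^ 4 / 24 * (eta ^ 2 / 24)
       + eta / 6 * (h * v0) - eta ^ 2 / 24 * (h * v1))) by (apply Rmult_le_pos; lra).
  assert (0 <= (h ^ 2 * (eta ^ 2 / 4) - (h ^ 2 - c ^ 2)) * v1) by (apply Rmult_le_pos; lra).
  assert (h ^ 2 * eta * v0 = (h ^ 2 - k ^ 2) * v0) by (now rewrite Heq).
  nra. }
assert (Hch : c <= h) by nra.
destruct (gap_ratio h c Hh ltac:(lra) Hch) as [Hf Hfq].
set (f := 1 - c ^ 2 / h ^ 2) in *.
assert (Hf1 : eta ^ 2 / 4 < f) by nra.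
assert (Hef : f <= eta) by nra.
assert (He0 : 0 < eta) by nra.
pose proof (slack_three h k c Hh Hk Hkc Hch) as S3.
pose proof (piece_sym h u0 u1 v0 v1 eta He Hp) as HY.
assert (Hr : f / eta <= 1) by (apply Rle_div_l; lra).
assert (Hr0 : eta / 4 < f / eta) by (apply (Rmult_lt_reg_r eta); [lra|]; replace (f / eta * eta) with f by (field; lra); lra).
set (r := f / eta) in *.
assert (Hre : f = r * eta) by (unfold r; field; lra).
(* Equality in [Hb] would need (r - eta / 4) / (1 - eta / 4); this weight is no smaller and makes l
   eta^2 a polynomial in eta and f, as in [slack_three]. *)
set (l := r - (eta - f) / 4).
assert (Hl : 0 <= l <= 1) by (unfold l; nra).
(* The mixture l piece_sym + (1 - l) piece_single controls both slopes. *)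
assert (Hb : r <= l + (1 - l) * (eta / 4)).
{ unfold l; rewrite Hre; nra. }
assert (HZ : 0 <= u0 + u1 + h ^ 4 / 24 * (eta ^ 2 / 24 + l * eta ^ 2 / 72)
               + eta / 6 * (h * v0) - f / 6 * (h * v1)).
{ assert (0 <= (l + (1 - l) * (eta / 4) - r) * (eta * (h * v1))).
  { apply Rmult_le_pos; [lra|]; apply Rmult_le_pos; lra. }
  assert (0 <= l * (u0 + u1 + h ^ 4 / 24 * (eta ^ 2 / 18) + eta / 6 * (h * v0) - eta / 6 * (h * v1)))
    by (apply Rmult_le_pos; lra).
  assert (0 <= (1 - l) * (u0 + u1 + h ^ 4 / 24 * (eta ^ 2 / 24)
       + eta / 6 * (h * v0) - eta ^ 2 / 24 * (h * v1))) by (apply Rmult_le_pos; lra).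
  rewrite Hre; lra. }
assert (HZ' : 0 <= h / 2 * (u0 + u1 + h ^ 4 / 24 * (eta ^ 2 / 24 + l * eta ^ 2 / 72)
               + eta / 6 * (h * v0) - f / 6 * (h * v1))) by (apply Rmult_le_pos; lra).
replace (c ^ 2 - k ^ 2) with ((h ^ 2 - k ^ 2) - (h ^ 2 - c ^ 2)) in S3 by ring.
rewrite <- Heq, <- Hfq in S3.
assert (S3' : h ^ 5 * (eta ^ 2 / 4 + eta * f / 12 - eta ^ 2 * (eta - f) / 48) / 288
              <= slack h + slack k / 2 + slack c / 2).
{ apply Rmult_le_reg_l with h; [lra|].
  eapply Rle_trans; [|exact S3]; apply Req_le; field. }
assert (Hle : l * eta ^ 2 = eta * f - eta ^ 2 * (eta - f) / 4).
{ unfold l; rewrite Hre; field. }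
replace (k ^ 2) with (h ^ 2 - h ^ 2 * eta) by lra.
replace (c ^ 2) with (h ^ 2 - h ^ 2 * f) by lra.
replace (l * eta ^ 2 / 72) with ((eta * f - eta ^ 2 * (eta - f) / 4) / 72) in HZ' by (rewrite <- Hle; field).
lra.
Qed.

Lemma valley_bound h u0 u1 v0 v1 k c :
  0 < h -> 0 <= u0 -> 0 <= u1 -> v0 <= 0 -> 0 <= v1 -> 0 <= k -> 0 <= c ->
  (forall t, 0 <= t <= 1 -> 0 <= piece h u0 u1 v0 v1 t) ->
  0 <= h / 2 * (u0 + u1) + h ^ 2 / 12 * (v0 - v1) + slack h
       - k ^ 2 * v0 / 12 + slack k / 2 + c ^ 2 * v1 / 12 + slack c / 2.
Proof.
intros Hh Hu0 Hu1 Hv0 Hv1 Hk Hc Hp.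
destruct (Rle_dec k c) as [Hkc|Hkc].
- now apply valley_bound_ordered.
- assert (H := valley_bound_ordered h u1 u0 (- v1) (- v0) c k).
  assert (0 <= h / 2 * (u1 + u0) + h ^ 2 / 12 * (- v1 - - v0) + slack h - c ^ 2 * - v1 / 12
               + slack c / 2 + k ^ 2 * - v0 / 12 + slack k / 2); [|lra].
  apply H; try lra.
  intros t Ht; replace t with (1 - (1 - t)) by ring; rewrite piece_mirror; apply Hp; lra.
Qed.

(** Let k attain psi (- v0). If k > h, the length h is tested in psi (- v1). Otherwise h / 2 times
    [piece_single] leaves - v1 with coefficient (2 h^2 + k^2) / 36; by convexity of the square the
    test length (2 h + k) / 3 works, or 1, where [slack] vanishes, if that mean exceeds 1. *)
Lemma slope_bound h u0 u1 v0 v1 :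
  0 < h -> 0 <= u0 -> 0 <= u1 -> v0 <= 0 -> v1 <= 0 ->
  (forall t, 0 <= t <= 1 -> 0 <= piece h u0 u1 v0 v1 t) ->
  psi (- v1) <= h / 2 * (u0 + u1) + h ^ 2 / 12 * (v0 - v1) + slack h + psi (- v0).
Proof.
intros Hh Hu0 Hu1 Hv0 Hv1 Hp.
destruct (psi_attained (- v0)) as [k [Hk ->]].
pose proof (slack_nonneg h ltac:(lra)) as Sh.
pose proof (slack_nonneg k ltac:(lra)) as Sk.
destruct (Rle_dec k h) as [Hkh|Hkh].
2:{ eapply Rle_trans; [apply (psi_le _ h); lra|].
    assert (0 <= h * (u0 + u1)) by nra.
    assert (0 <= (k ^ 2 - h ^ 2) * - v0) by (apply Rmult_le_pos; nra).
    lra. }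
destruct (gap_ratio h k Hh ltac:(lra) Hkh) as [He Heq].
set (eta := 1 - k ^ 2 / h ^ 2) in *.
pose proof (piece_single h u0 u1 v0 v1 eta Hu0 Hu1 He Hp) as HS.
assert (Hkappa : eta / (4 - eta) <= 1 / 3) by (apply Rle_div_l; lra).
assert (Hhv1 : 0 <= h * - v1) by nra.
assert (HS' : 0 <= h / 2 * (u0 + u1 + h ^ 4 / 24 * (eta ^ 2 / 24)
       + eta / 6 * (h * v0) + eta / 18 * (h * - v1))).
{ apply Rmult_le_pos; [lra|].
  assert (0 <= (1 / 3 - eta / (4 - eta)) * (eta * (h * - v1))); [|nra].
  apply Rmult_le_pos; [lra|]; apply Rmult_le_pos; lra. }
clear HS Hkappa.
assert (Hcost : h * (h ^ 2 - k ^ 2) ^ 2 = h ^ 5 * eta ^ 2) by (rewrite <- Heq; ring).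
assert (Hm : ((2 * h + k) / 3) ^ 2 <= (2 * h ^ 2 + k ^ 2) / 3) by nra.
assert (H0 : h ^ 2 * eta * v0 = (h ^ 2 - k ^ 2) * v0) by (now rewrite Heq).
assert (H1 : h ^ 2 * eta * v1 = (h ^ 2 - k ^ 2) * v1) by (now rewrite Heq).
destruct (Rle_dec ((2 * h + k) / 3) 1) as [Hm1|Hm1].
- pose proof (slack_two_mean h k Hh ltac:(lra) Hkh) as S2.
  eapply Rle_trans; [apply (psi_le _ ((2 * h + k) / 3)); lra|].
  assert (0 <= ((2 * h ^ 2 + k ^ 2) / 3 - ((2 * h + k) / 3) ^ 2) * - v1) by (apply Rmult_le_pos; lra).
  lra.
- pose proof (slack_two h k Hh ltac:(lra) Hkh) as S2.
  eapply Rle_trans; [apply (psi_le _ 1); lra|].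
  assert (0 <= ((2 * h ^ 2 + k ^ 2) / 3 - 1) * - v1) by (apply Rmult_le_pos; nra).
  replace (slack 1) with 0 by (unfold slack; field).
  lra.
Qed.

(** The cases are the signs of the slopes. Equal signs reduce to [slope_bound], up to reflection; a
    hill follows by testing both [psi] at min(h, 1); a valley is [valley_bound]. *)
Lemma interval_bound h u0 u1 v0 v1 :
  0 < h -> 0 <= u0 -> 0 <= u1 ->
  (forall t, 0 <= t <= 1 -> 0 <= piece h u0 u1 v0 v1 t) ->
  phi v0 - phi v1 <= h / 2 * (u0 + u1) + h ^ 2 / 12 * (v0 - v1) + slack h.
Proof.
intros Hh Hu0 Hu1 Hp.
assert (Hu : 0 <= h * (u0 + u1)) by nra.
pose proof (slack_nonneg h ltac:(lra)) as Sh.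
assert (Hn : forall v, v <= 0 -> phi v = - psi (- v)).
{ intros v Hv; rewrite <- (Ropp_involutive v) at 1; rewrite phi_opp, phi_pos; lra. }
destruct (Rle_dec 0 v0) as [H0|H0]; destruct (Rle_dec 0 v1) as [H1|H1].
- rewrite (phi_pos v0), (phi_pos v1) by lra.
  assert (H := slope_bound h u1 u0 (- v1) (- v0)).
  rewrite !Ropp_involutive in H.
  assert (psi v0 <= h / 2 * (u1 + u0) + h ^ 2 / 12 * (- v1 - - v0) + slack h + psi v1); [|lra].
  apply H; try lra.
  intros t Ht; replace t with (1 - (1 - t)) by ring; rewrite piece_mirror; apply Hp; lra.
- rewrite (phi_pos v0), (Hn v1) by lra.
  destruct (Rle_dec h 1) as [Hh1|Hh1].
  + pose proof (psi_le v0 h ltac:(lra)); pose proof (psi_le (- v1) h ltac:(lra)); lra.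
  + pose proof (psi_le v0 1 ltac:(lra)); pose proof (psi_le (- v1) 1 ltac:(lra)).
    assert (slack 1 = 0) by (unfold slack; field).
    assert (0 <= (h ^ 2 - 1) * (v0 - v1)) by (apply Rmult_le_pos; nra).
    lra.
- rewrite (phi_pos v1), (Hn v0) by lra.
  destruct (psi_attained (- v0)) as [k [Hk ->]].
  destruct (psi_attained v1) as [c [Hc ->]].
  assert (H := valley_bound h u0 u1 v0 v1 k c).
  assert (0 <= h / 2 * (u0 + u1) + h ^ 2 / 12 * (v0 - v1) + slack h
       - k ^ 2 * v0 / 12 + slack k / 2 + c ^ 2 * v1 / 12 + slack c / 2) by (apply H; auto; lra).
  lra.
- rewrite (Hn v0), (Hn v1) by lra.
  assert (H := slope_bound h u0 u1 v0 v1 Hh Hu0 Hu1 ltac:(lra) ltac:(lra) Hp); lra.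
Qed.

(** * Lower bound for the error constant *)

Lemma D_in_of_is_derive (f f' : R -> R) (D : R -> Prop) x :
  is_derive f x (f' x) -> D_in f f' D x.
Proof.
intros H; apply is_derive_Reals in H.
intros eps Heps; destruct (H eps Heps) as [d Hd].
exists d; split; [apply cond_pos|].
intros y [[_ Hy] Hxy]; simpl in Hxy; unfold Rdist in Hxy.
assert (H' := Hd (y - x) ltac:(lra) Hxy).
assert (E : x + (y - x) = y) by lra; rewrite E in H'; exact H'.
Qed.

Lemma C4_01_of_derive (f0 f1 f2 f3 f4 : R -> R) :
  (forall x, is_derive f0 x (f1 x)) -> (forall x, is_derive f1 x (f2 x)) ->
  (forall x, is_derive f2 x (f3 x)) -> (forall x, is_derive f3 x (f4 x)) ->
  (forall x, continuous f4 x) -> C4_01 f0 f4.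
Proof.
intros H0 H1 H2 H3 H4; split.
- exists f1; split; [intros x _; now apply D_in_of_is_derive|].
  exists f2; split; [intros x _; now apply D_in_of_is_derive|].
  exists f3; split; [intros x _; now apply D_in_of_is_derive|].
  exists f4; split; [intros x _; now apply D_in_of_is_derive|].
  simpl; reflexivity.
- intros x _ eps Heps.
  destruct (proj2 (continuity_pt_filterlim f4 x) (H4 x) eps Heps) as [d [Hd Hd']].
  exists d; split; [exact Hd|].
  intros y [[_ Hy] Hxy]; apply Hd'; split; [split; [exact I|exact Hy]|exact Hxy].
Qed.

(** * Truncated powers and smooth test functions *)

Definition ppart (x : R) : R := Rmax 0 x.

Lemma ppart_ge x : 0 <= x -> ppart x = x.
Proof. intros; unfold ppart; now apply Rmax_right. Qed.

Lemma ppart_le x : x <= 0 -> ppart x = 0.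
Proof. intros; unfold ppart; now apply Rmax_left. Qed.

Lemma continuous_ppart b x : continuous (fun x => ppart (x - b)) x.
Proof.
apply continuity_pt_filterlim; intros eps Heps.
exists eps; split; [lra|].
intros y [_ Hy]; simpl in *; unfold Rdist in *.
eapply Rle_lt_trans; [|exact Hy].
unfold ppart, Rmax; destruct Rle_dec; destruct Rle_dec; unfold Rabs; repeat destruct Rcase_abs; lra.
Qed.

Lemma is_derive_ppart_sqr b x : is_derive (fun x => ppart (x - b) ^ 2) x (2 * ppart (x - b)).
Proof.
apply is_derive_Reals; intros eps Heps.
exists (mkposreal eps Heps); intros h Hh Hhe; simpl in Hhe.
assert (H : Rabs (ppart (x + h - b) ^ 2 - ppart (x - b) ^ 2 - 2 * ppart (x - b) * h) <= Rabs h * Rabs h).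
{ rewrite <- Rabs_mult; rewrite (Rabs_right (h * h)) by nra.
  apply Rabs_le; unfold ppart, Rmax; destruct Rle_dec; destruct Rle_dec; nra. }
replace ((ppart (x + h - b) ^ 2 - ppart (x - b) ^ 2) / h - 2 * ppart (x - b))
  with ((ppart (x + h - b) ^ 2 - ppart (x - b) ^ 2 - 2 * ppart (x - b) * h) / h) by (field; exact Hh).
rewrite Rabs_div by exact Hh.
eapply Rle_lt_trans; [|exact Hhe].
assert (0 < Rabs h) by now apply Rabs_pos_lt.
now apply Rle_div_l.
Qed.

Lemma is_derive_ppart_pow n b x :
  is_derive (fun x => ppart (x - b) ^ (n + 2)) x (INR (n + 2) * ppart (x - b) ^ (n + 1)).
Proof.
(* All factors but two may be replaced by the smooth power (x - b)^n, so the square and the product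
   rule suffice. *)
assert (Hpow : forall y m, ppart y * y ^ m = ppart y * ppart y ^ m).
{ intros y m; destruct (Rle_dec 0 y); [rewrite ppart_ge by lra|rewrite ppart_le by lra]; ring. }
apply is_derive_ext with (fun x => ppart (x - b) ^ 2 * (x - b) ^ n).
{ intros t; rewrite Nat.add_comm, pow_add; simpl; rewrite !Rmult_assoc, !Rmult_1_l.
  f_equal; apply Hpow. }
assert (E : is_derive (fun x => (x - b) ^ n) x (INR n * (x - b) ^ pred n)).
{ auto_derive; trivial; unfold Rminus; ring. }
assert (H := is_derive_mult _ _ _ _ _ (is_derive_ppart_sqr b x) E ltac:(intros; apply Rmult_comm)).
unfold mult, plus in H; simpl in H.
match type of H with is_derive _ _ ?l => replace (INR (n + 2) * ppart (x - b) ^ (n + 1)) with l end.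
exact H.
generalize (x - b); intros y; rewrite plus_INR, pow_add, pow_1; simpl (INR 2).
destruct n as [|n].
- simpl; ring.
- rewrite Nat.pred_succ.
  replace (2 * ppart y * y ^ S n + ppart y * (ppart y * 1) * (INR (S n) * y ^ n))
    with (2 * (ppart y * y ^ S n) + ppart y * INR (S n) * (ppart y * y ^ n)) by ring.
  rewrite !Hpow; simpl (ppart y ^ S n); ring.
Qed.

(* A C^4 approximation of (x - t)_+^3 / 6 with nonnegative fourth derivative [hat t d]. *)
Definition hat_spline (t d x : R) : R :=
  (ppart (x - (t - d)) ^ 5 - 2 * ppart (x - t) ^ 5 + ppart (x - (t + d)) ^ 5) / (120 * d ^ 2).

Definition hat (t d x : R) : R :=
  (ppart (x - (t - d)) - 2 * ppart (x - t) + ppart (x - (t + d))) / d ^ 2.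

Lemma C4_hat_spline t d : 0 < d -> C4_01 (hat_spline t d) (hat t d).
Proof.
intros Hd.
(* A single differentiation; k and j run through consecutive terms of 120, 24, 6, 2, 1. *)
assert (Hgen : forall m k j x, k = INR (m + 2) * j -> j <> 0 -> is_derive
  (fun x => (ppart (x - (t - d)) ^ (m + 2) - 2 * ppart (x - t) ^ (m + 2) + ppart (x - (t + d)) ^ (m + 2)) / (k * d ^ 2)) x
  ((ppart (x - (t - d)) ^ (m + 1) - 2 * ppart (x - t) ^ (m + 1) + ppart (x - (t + d)) ^ (m + 1)) / (j * d ^ 2))).
{ intros m k j x Hk Hj.
  assert (Hm : INR (m + 2) <> 0) by (apply not_0_INR; lia).
  assert (H1 := is_derive_ppart_pow m (t - d) x).
  assert (H2 := is_derive_ppart_pow m t x).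
  assert (H3 := is_derive_ppart_pow m (t + d) x).
  assert (H := is_derive_scal _ x (/ (k * d ^ 2)) _ (is_derive_plus _ _ _ _ _ (is_derive_minus _ _ _ _ _ H1 (is_derive_scal _ x 2 _ H2)) H3)).
  unfold plus, minus, opp, scal in H; simpl in H.
  eapply is_derive_ext; [|match type of H with is_derive _ _ ?l => replace (_ / _) with l end; [exact H|]].
  - intros y; simpl; unfold Rdiv, plus, minus, opp; simpl; ring.
  - unfold plus, minus, opp; simpl; unfold plus, opp; simpl; rewrite Hk; field; repeat split; lra. }
apply C4_01_of_derive with
  (fun x => (ppart (x - (t - d)) ^ 4 - 2 * ppart (x - t) ^ 4 + ppart (x - (t + d)) ^ 4) / (24 * d ^ 2))
  (fun x => (ppart (x - (t - d)) ^ 3 - 2 * ppart (x - t) ^ 3 + ppart (x - (t + d)) ^ 3) / (6 * d ^ 2))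
  (fun x => (ppart (x - (t - d)) ^ 2 - 2 * ppart (x - t) ^ 2 + ppart (x - (t + d)) ^ 2) / (2 * d ^ 2)).
- intros x; apply (Hgen 3%nat); simpl; lra.
- intros x; apply (Hgen 2%nat); simpl; lra.
- intros x; apply (Hgen 1%nat); simpl; lra.
- intros x; assert (H := Hgen 0%nat 2 1 x ltac:(simpl; lra) ltac:(lra)).
  unfold hat; simpl (0 + 1)%nat in H; rewrite !pow_1, Rmult_1_l in H; exact H.
- intros x; unfold hat, Rdiv.
  apply (continuous_mult (fun x => ppart (x - (t - d)) - 2 * ppart (x - t) + ppart (x - (t + d))) (fun _ => / d ^ 2)); [|apply continuous_const].
  apply (continuous_plus (fun x => ppart (x - (t - d)) - 2 * ppart (x - t))); [|apply continuous_ppart].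
  apply (continuous_minus (fun x => ppart (x - (t - d)))); [apply continuous_ppart|].
  apply (continuous_scal_r 2 (fun x => ppart (x - t))), continuous_ppart.
Qed.

Lemma hat_nonneg t d x : 0 < d -> 0 <= hat t d x.
Proof.
intros Hd; apply Rdiv_le_0_compat; [|now apply pow_lt].
unfold ppart, Rmax; repeat destruct Rle_dec; lra.
Qed.

(** For x - t >= d the difference is exactly (x - t) d^2 / 12, for x - t <= - d it is 0, and in
    between every term has order d^3. *)
Lemma hat_spline_close t d x : 0 < d < 1 -> Rabs (x - t) <= 1 ->
  Rabs (hat_spline t d x - ppart (x - t) ^ 3 / 6) <= d ^ 2.
Proof.
intros Hd Hx; apply Rabs_le_between in Hx.
set (y := x - t) in *.
unfold hat_spline.
replace (x - (t - d)) with (y + d) by (unfold y; ring).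
replace (x - (t + d)) with (y - d) by (unfold y; ring).
fold y; clearbody y.
assert (Hd2 : 0 < d ^ 2) by (apply pow_lt; lra).
destruct (Rle_dec d y) as [H1|H1].
{ rewrite !ppart_ge by lra.
  replace (_ - _) with (y * d ^ 2 / 12) by (field; lra).
  rewrite Rabs_right; [|apply Rle_ge, Rdiv_le_0_compat; [nra|lra]]; nra. }
destruct (Rle_dec y (- d)) as [H2|H2].
{ rewrite !ppart_le by lra.
  replace (_ - _) with 0 by (field; lra).
  rewrite Rabs_R0; lra. }
rewrite (ppart_ge (y + d)), (ppart_le (y - d)) by lra.
assert (Hp : 0 <= ppart y <= d) by (unfold ppart, Rmax; destruct Rle_dec; lra).
set (p := ppart y) in *; clearbody p.
assert (H5 : forall a n, 0 <= a <= d -> 0 <= a ^ n <= d ^ n).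
{ intros a n Ha; split; [apply pow_le; lra|apply pow_incr; lra]. }
assert (Hq : 0 <= (y + d) ^ 5 <= 32 * d ^ 5).
{ replace (32 * d ^ 5) with ((2 * d) ^ 5) by ring.
  split; [apply pow_le; lra|apply pow_incr; lra]. }
pose proof (H5 p 5%nat Hp) as Hp5.
pose proof (H5 p 3%nat Hp) as Hp3.
assert (Hd3 : d ^ 3 <= d ^ 2) by (replace (d ^ 3) with (d ^ 2 * d) by ring; nra).
replace (((y + d) ^ 5 - 2 * p ^ 5 + 0 ^ 5) / (120 * d ^ 2) - p ^ 3 / 6)
  with (((y + d) ^ 5 - 2 * p ^ 5 - 20 * (p ^ 3 * d ^ 2)) / (120 * d ^ 2)) by (field; lra).
assert (Hpd : 0 <= p ^ 3 * d ^ 2 <= d ^ 5).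
{ replace (d ^ 5) with (d ^ 3 * d ^ 2) by ring; nra. }
assert (Hd5 : d ^ 5 <= d ^ 4).
{ replace (d ^ 5) with (d ^ 3 * d ^ 2) by ring; replace (d ^ 4) with (d ^ 2 * d ^ 2) by ring; nra. }
apply Rabs_le; split.
- apply (Rmult_le_reg_r (120 * d ^ 2)); [lra|].
  replace (_ / _ * _) with ((y + d) ^ 5 - 2 * p ^ 5 - 20 * (p ^ 3 * d ^ 2)) by (field; lra).
  replace (- d ^ 2 * (120 * d ^ 2)) with (- 120 * d ^ 4) by ring; lra.
- apply (Rmult_le_reg_r (120 * d ^ 2)); [lra|].
  replace (_ / _ * _) with ((y + d) ^ 5 - 2 * p ^ 5 - 20 * (p ^ 3 * d ^ 2)) by (field; lra).
  replace (d ^ 2 * (120 * d ^ 2)) with (120 * d ^ 4) by ring; lra.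
Qed.

Lemma sum_n_m_le_loc (a b : nat -> R) m n :
  (forall i, (m <= i <= n)%nat -> a i <= b i) -> sum_n_m a m n <= sum_n_m b m n.
Proof.
intros H.
rewrite (sum_n_m_ext_loc a (fun i => if excluded_middle_informative (m <= i <= n)%nat then a i else 0)).
rewrite (sum_n_m_ext_loc b (fun i => if excluded_middle_informative (m <= i <= n)%nat then b i else 0)).
- apply sum_n_m_le; intros k; destruct excluded_middle_informative; [auto|lra].
- intros k Hk; destruct excluded_middle_informative; tauto.
- intros k Hk; destruct excluded_middle_informative; tauto.
Qed.

Lemma continuous_ppart_pow k b x : continuous (fun x => ppart (x - b) ^ k) x.
Proof.
induction k as [|k IH].
- apply continuous_const.
- apply (continuous_mult (fun x => ppart (x - b))); [apply continuous_ppart|exact IH].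
Qed.

Lemma continuous_hat_spline t d x : continuous (hat_spline t d) x.
Proof.
unfold hat_spline, Rdiv.
apply (continuous_mult (fun x => ppart (x - (t - d)) ^ 5 - 2 * ppart (x - t) ^ 5 + ppart (x - (t + d)) ^ 5) (fun _ => / (120 * d ^ 2))); [|apply continuous_const].
apply (continuous_plus (fun x => ppart (x - (t - d)) ^ 5 - 2 * ppart (x - t) ^ 5)); [|apply continuous_ppart_pow].
apply (continuous_minus (fun x => ppart (x - (t - d)) ^ 5)); [apply continuous_ppart_pow|].
apply (continuous_scal_r 2 (fun x => ppart (x - t) ^ 5)), continuous_ppart_pow.
Qed.

Lemma is_RInt_ppart_cube t : 0 <= t <= 1 ->
  is_RInt (fun x => ppart (x - t) ^ 3 / 6) 0 1 ((1 - t) ^ 4 / 24).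
Proof.
intros Ht.
replace ((1 - t) ^ 4 / 24) with (minus (ppart (1 - t) ^ 4 / 24) (ppart (0 - t) ^ 4 / 24)).
- apply (is_RInt_derive (fun x => ppart (x - t) ^ 4 / 24)).
  + intros x _.
    assert (H := is_derive_scal _ x (/ 24) _ (is_derive_ppart_pow 2 t x)).
    eapply is_derive_ext; [|match type of H with is_derive _ _ ?l => replace (_ / 6) with l end; [exact H|]].
    * intros y; simpl; unfold Rdiv; ring.
    * unfold scal; simpl; unfold mult; simpl; field.
  + intros x _; apply (continuous_mult (fun x => ppart (x - t) ^ 3) (fun _ => / 6));
      [apply continuous_ppart_pow|apply continuous_const].
- rewrite ppart_ge, ppart_le by lra; unfold minus, plus, opp; simpl; field.
Qed.

(* (1 - t)^(k+1) / (k+1)! - psum k t / k! is the remainder of x |-> (x - t)_+^k / k!,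
   that is the Peano kernel for k = 3 and minus its derivative for k = 2. *)
Definition psum (a tau : nat -> R) (N k : nat) (t : R) : R :=
  sum_n_m (fun i => a i * ppart (tau i - t) ^ k) 1 N.

Lemma sum_n_m_linear (p q : R) (u v : nat -> R) m n :
  sum_n_m (fun i => p * u i + q * v i) m n = p * sum_n_m u m n + q * sum_n_m v m n.
Proof.
exact (eq_trans (sum_n_m_plus (fun i => p * u i) (fun i => q * v i) m n)
  (f_equal2 Rplus (sum_n_m_mult_l (p : R_Ring) u m n) (sum_n_m_mult_l (q : R_Ring) v m n))).
Qed.

(** The remainder of [hat_spline] is nonnegative because [hat] is. As d tends to 0 it approaches the
    remainder of (x - t)_+^3 / 6, the kernel at t, with error at most d^2 (1 + A). *)
Lemma kernel_nonneg N (Q : (R -> R) -> R) c a tau t :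
  (forall i, (1 <= i <= N)%nat -> 0 <= tau i <= 1) ->
  (forall f : R -> R, Q f = sum_n_m (fun i => a i * f (tau i)) 1 N) ->
  is_error_constant4 Q c -> 0 <= t <= 1 ->
  0 <= (1 - t) ^ 4 / 24 - psum a tau N 3 t / 6.
Proof.
intros Htau HQ [Hc HR] Ht.
set (A := sum_n_m (fun i => Rabs (a i)) 1 N : R).
assert (HA : 0 <= A).
{ unfold A; rewrite <- (Rmult_0_r (INR (S N - 1))), <- (sum_n_m_const 1 N 0).
  apply sum_n_m_le; intros; apply Rabs_pos. }
assert (Hd : forall d, 0 < d < 1 -> - (d ^ 2 * (1 + A)) <= (1 - t) ^ 4 / 24 - psum a tau N 3 t / 6).
{ intros d Hd.
  destruct (HR _ _ (C4_hat_spline t d ltac:(lra))) as [xi [_ Hxi]].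
  assert (H0 : 0 <= remainder Q (hat_spline t d)).
  { rewrite Hxi; apply Rmult_le_pos; [lra|apply hat_nonneg; lra]. }
  unfold remainder in H0; rewrite HQ in H0.
  assert (H1 : RInt (hat_spline t d) 0 1 <= (1 - t) ^ 4 / 24 + d ^ 2).
  { assert (HI : is_RInt (fun x => ppart (x - t) ^ 3 / 6 + d ^ 2) 0 1 ((1 - t) ^ 4 / 24 + d ^ 2)).
    { apply (is_RInt_plus (fun x => ppart (x - t) ^ 3 / 6)); [now apply is_RInt_ppart_cube|].
      assert (HC := is_RInt_const 0 1 (d ^ 2)).
      unfold scal in HC; simpl in HC; unfold mult in HC; simpl in HC.
      rewrite Rminus_0_r, Rmult_1_l in HC; exact HC. }
    rewrite <- (is_RInt_unique _ _ _ _ HI).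
    apply RInt_le; [lra| |eexists; exact HI|].
    - apply (ex_RInt_continuous (hat_spline t d)); intros; apply continuous_hat_spline.
    - intros x Hx.
      assert (H := hat_spline_close t d x Hd ltac:(apply Rabs_le; lra)).
      apply Rabs_le_between in H; lra. }
  assert (H2 : psum a tau N 3 t / 6 - d ^ 2 * A <= sum_n_m (fun i => a i * hat_spline t d (tau i)) 1 N).
  { unfold psum, A.
    replace (_ - _) with (sum_n_m (fun i => / 6 * (a i * ppart (tau i - t) ^ 3) + - d ^ 2 * Rabs (a i)) 1 N).
    - apply sum_n_m_le_loc; intros i Hi.
      assert (H := hat_spline_close t d (tau i) Hd ltac:(specialize (Htau i Hi); apply Rabs_le; lra)).
      apply Rabs_le_between in H.
      assert (H' : Rabs (a i * (hat_spline t d (tau i) - ppart (tau i - t) ^ 3 / 6)) <= Rabs (a i) * d ^ 2).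
      { rewrite Rabs_mult; apply Rmult_le_compat_l; [apply Rabs_pos|apply Rabs_le; lra]. }
      apply Rabs_le_between in H'; lra.
    - rewrite sum_n_m_linear; eq_R; field. }
  lra. }
apply Rnot_lt_le; intros Hneg.
set (K := (1 - t) ^ 4 / 24 - psum a tau N 3 t / 6) in *.
(* This d gives d^2 (1 + A) < d (1 + A) <= - K, against [Hd]. *)
assert (Hd0 : 0 < Rmin (1 / 2) (- K / (1 + A))).
{ apply Rmin_glb_lt; [lra|apply Rdiv_lt_0_compat; lra]. }
pose proof (Rmin_l (1 / 2) (- K / (1 + A))) as Hl.
pose proof (Rmin_r (1 / 2) (- K / (1 + A))) as Hr.
set (d := Rmin _ _) in *.
specialize (Hd d ltac:(lra)).
assert (d * (1 + A) <= - K) by (apply Rle_div_r; lra).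
assert (0 < d * (1 + A)) by (apply Rmult_lt_0_compat; lra).
nra.
Qed.

(** * The kernel between consecutive nodes *)

Lemma psum_S a tau n k t :
  psum a tau (S n) k t = psum a tau n k t + a (S n) * ppart (tau (S n) - t) ^ k.
Proof. unfold psum; rewrite sum_n_Sm by lia; reflexivity. Qed.

Lemma psum_0 a tau k t : psum a tau 0 k t = 0.
Proof. unfold psum; rewrite sum_n_m_zero by lia; reflexivity. Qed.

(** With no node strictly between x and y, psum 3 / 6 is a cubic there, with derivative - psum 2 / 2
    and antiderivative - psum 4 / 24; the corrected trapezoidal rule is exact for cubics. *)
Lemma psum_trapezoid n a tau x y :
  x <= y -> (forall i, (1 <= i <= n)%nat -> tau i <= x \/ y <= tau i) ->
  psum a tau n 4 x / 24 - psum a tau n 4 y / 24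
  = (y - x) / 2 * (psum a tau n 3 x / 6 + psum a tau n 3 y / 6)
    + (y - x) ^ 2 / 12 * (psum a tau n 2 y / 2 - psum a tau n 2 x / 2).
Proof.
intros Hxy; induction n as [|n IH]; intros H.
- rewrite !psum_0; field.
- rewrite !psum_S.
  assert (IH' := IH ltac:(intros; apply H; lia)).
  set (p := psum a tau n) in *; clearbody p.
  destruct (H (S n) ltac:(lia)) as [Hn|Hn].
  + rewrite !ppart_le by lra; rewrite !pow_i by lia; lra.
  + rewrite !ppart_ge by lra; lra.
Qed.

(** On a node-free interval a cubic is its own Hermite interpolant. *)
Lemma psum_hermite n a tau x y t :
  x <= y -> 0 <= t <= 1 -> (forall i, (1 <= i <= n)%nat -> tau i <= x \/ y <= tau i) ->
  psum a tau n 3 (x + t * (y - x)) / 6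
  = psum a tau n 3 x / 6 * ((1 - t) ^ 2 * (1 + 2 * t))
    + psum a tau n 3 y / 6 * (t ^ 2 * (3 - 2 * t))
    - (y - x) * (psum a tau n 2 x / 2) * (t * (1 - t) ^ 2)
    + (y - x) * (psum a tau n 2 y / 2) * (t ^ 2 * (1 - t)).
Proof.
intros Hxy Ht; induction n as [|n IH]; intros H.
- rewrite !psum_0; field.
- rewrite !psum_S.
  assert (IH' := IH ltac:(intros; apply H; lia)).
  set (p := psum a tau n) in *; clearbody p.
  assert (Hs : 0 <= t * (y - x) <= y - x) by nra.
  destruct (H (S n) ltac:(lia)) as [Hn|Hn].
  + rewrite !ppart_le by lra; rewrite !pow_i by lia; lra.
  + rewrite !ppart_ge by lra; lra.
Qed.

Lemma C4_01_poly (p0 p1 p2 p3 p4 : R) :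
  C4_01 (fun x => p0 + p1 * x + p2 * x ^ 2 / 2 + p3 * x ^ 3 / 6 + p4 * x ^ 4 / 24) (fun _ => p4).
Proof.
apply C4_01_of_derive with (fun x => p1 + p2 * x + p3 * x ^ 2 / 2 + p4 * x ^ 3 / 6)
  (fun x => p2 + p3 * x + p4 * x ^ 2 / 2) (fun x => p3 + p4 * x);
 try (intros x; auto_derive; trivial; field).
intros x; apply continuous_const.
Qed.

Lemma is_RInt_poly (p0 p1 p2 p3 p4 : R) :
  is_RInt (fun x => p0 + p1 * x + p2 * x ^ 2 / 2 + p3 * x ^ 3 / 6 + p4 * x ^ 4 / 24) 0 1
    (p0 + p1 / 2 + p2 / 6 + p3 / 24 + p4 / 120).
Proof.
set (F := fun x => p0 * x + p1 * x ^ 2 / 2 + p2 * x ^ 3 / 6 + p3 * x ^ 4 / 24 + p4 * x ^ 5 / 120).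
replace (_ + p4 / 120) with (minus (F 1) (F 0)) by (unfold F, minus, plus, opp; simpl; field).
apply (is_RInt_derive F).
- intros x _; unfold F; auto_derive; trivial; field.
- intros x _; apply (@ex_derive_continuous R_AbsRing R_NormedModule); auto_derive; trivial.
Qed.

(** At t = 0 the truncated powers are plain powers at the nodes. Testing on x^2 / 2 gives K'(0) = 0,
    and on x^4 / 24 that c is the integral of K. *)
Lemma psum_at_0 N (Q : (R -> R) -> R) c a tau :
  (forall i, (1 <= i <= N)%nat -> 0 <= tau i <= 1) ->
  (forall f : R -> R, Q f = sum_n_m (fun i => a i * f (tau i)) 1 N) ->
  is_error_constant4 Q c ->
  1 / 6 - psum a tau N 2 0 / 2 = 0 /\
  1 / 120 - psum a tau N 4 0 / 24 = c.
Proof.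
intros Htau HQ [Hc HR].
assert (HS : forall p2 p3 p4, p2 / 6 + p3 / 24 + p4 / 120
  - (p2 * psum a tau N 2 0 / 2 + p3 * psum a tau N 3 0 / 6 + p4 * psum a tau N 4 0 / 24) = c * p4).
{ intros p2 p3 p4.
  destruct (HR _ _ (C4_01_poly 0 0 p2 p3 p4)) as [xi [_ H]].
  unfold remainder in H; rewrite (is_RInt_unique _ _ _ _ (is_RInt_poly 0 0 p2 p3 p4)), HQ in H.
  rewrite <- H.
  match goal with |- ?u - ?v = ?u' - ?v' => assert (E : v = v'); [|rewrite E; field] end.
  clear HQ H HR; induction N as [|n IH].
  - rewrite !psum_0, sum_n_m_zero by lia; simpl; unfold zero; simpl; field.
  - rewrite !psum_S, sum_n_Sm by lia.
    rewrite <- IH by (intros; apply Htau; lia).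
    rewrite !Rminus_0_r, ppart_ge by (apply Htau; lia).
    unfold plus; simpl; field. }
split.
- assert (H := HS 1 0 0); lra.
- assert (H := HS 0 0 1); lra.
Qed.

Lemma piece_scale M h u0 u1 v0 v1 t :
  piece (M * h) (M ^ 4 * u0) (M ^ 4 * u1) (M ^ 3 * v0) (M ^ 3 * v1) t
  = M ^ 4 * piece h u0 u1 v0 v1 t.
Proof. unfold piece; field. Qed.

Lemma error_constant_lower N (Q : (R -> R) -> R) c :
  is_quadrature N Q -> is_error_constant4 Q c -> 1 / (720 * INR (N + 1) ^ 4) <= c.
Proof.
intros [tau [a [Htau [Hinc HQ]]]] Hec.
destruct (psum_at_0 N Q c a tau Htau HQ Hec) as [H20 H40].
(* Scaling by M, the number of cells, makes their mean length 1. Below, [P3] is the kernel K, [P2]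
   is - K', and [P4] is the integral of K over [t, 1]. *)
set (M := INR (N + 1)).
assert (HM : 0 < M) by (apply lt_0_INR; lia).
set (P2 := fun t => (1 - t) ^ 3 / 6 - psum a tau N 2 t / 2).
set (P3 := fun t => (1 - t) ^ 4 / 24 - psum a tau N 3 t / 6).
set (P4 := fun t => (1 - t) ^ 5 / 120 - psum a tau N 4 t / 24).
assert (HP3 : forall t, 0 <= t <= 1 -> 0 <= P3 t).
{ intros t Ht; unfold P3; now apply (kernel_nonneg N Q c). }
(* The nodes are framed by 0 and 1; an end cell degenerates when 0 or 1 is itself a node. *)
set (knot := fun i => if Nat.eqb i 0 then 0 else if Nat.leb i N then tau i else 1).
assert (Hk01 : forall i, 0 <= knot i <= 1).
{ intros i; unfold knot; destruct (Nat.eqb_spec i 0); [lra|].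
  destruct (Nat.leb_spec i N); [apply Htau; lia|lra]. }
assert (Hkle : forall i, knot i <= knot (S i)).
{ intros i; unfold knot at 1; destruct (Nat.eqb_spec i 0) as [->|Hi]; [apply Hk01|].
  destruct (Nat.leb_spec i N).
  - unfold knot; destruct (Nat.eqb_spec (S i) 0); [lia|].
    destruct (Nat.leb_spec (S i) N); [apply Rlt_le, Hinc; lia|apply Htau; lia].
  - unfold knot; destruct (Nat.eqb_spec (S i) 0); [lia|].
    destruct (Nat.leb_spec (S i) N); [lia|lra]. }
assert (Hmono : forall i j, (1 <= i)%nat -> (i <= j)%nat -> (j <= N)%nat -> tau i <= tau j).
{ intros i j H1 H2 H3; destruct (Nat.eq_dec i j) as [->|]; [lra|apply Rlt_le, Hinc; lia]. }
assert (Hgap : forall i j, (1 <= j <= N)%nat -> tau j <= knot i \/ knot (S i) <= tau j).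
{ intros i j Hj; destruct (Nat.le_gt_cases j i) as [Hji|Hji].
  - left; unfold knot; destruct (Nat.eqb_spec i 0); [lia|].
    destruct (Nat.leb_spec i N); [apply Hmono; lia|apply Htau; lia].
  - right; unfold knot; simpl Nat.eqb; cbv iota.
    destruct (Nat.leb_spec (S i) N); [apply Hmono; lia|lia]. }
(* The term h^5 / 720 in the exact integral of K cancels the one in [slack], which leaves the
   tangent line (5 h - 4) / 720. *)
assert (Hstep : forall i, M ^ 5 * (P4 (knot i) - P4 (knot (S i))) >=
  phi (M ^ 3 * - P2 (knot i)) - phi (M ^ 3 * - P2 (knot (S i)))
  + (5 * M * (knot (S i) - knot i) - 4) / 720).
{ intros i.
  specialize (Hkle i); specialize (Hgap i).
  pose proof (Hk01 i) as Hx; pose proof (Hk01 (S i)) as Hy.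
  set (x := knot i) in *; set (y := knot (S i)) in *; clearbody x y.
  assert (HT := psum_trapezoid N a tau x y Hkle Hgap).
  assert (HT' : P4 x - P4 y = (y - x) / 2 * (P3 x + P3 y) + (y - x) ^ 2 / 12 * (- P2 x - - P2 y) + (y - x) ^ 5 / 720).
  { unfold P2, P3, P4 in *; lra. }
  destruct (Rle_lt_or_eq_dec x y Hkle) as [Hlt|Heq].
  - assert (HB := interval_bound (M * (y - x)) (M ^ 4 * P3 x) (M ^ 4 * P3 y) (M ^ 3 * - P2 x) (M ^ 3 * - P2 y)).
    rewrite HT'.
    assert (HM4 : 0 <= M ^ 4) by (apply pow_le; lra).
    assert (HB' := HB ltac:(apply Rmult_lt_0_compat; lra)
      ltac:(apply Rmult_le_pos; auto) ltac:(apply Rmult_le_pos; auto)).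
    unfold slack in HB'.
    eapply Rge_trans; [|apply Rle_ge, Rplus_le_compat_r, HB'].
    + apply Req_ge; field.
    + intros t Ht; rewrite piece_scale; apply Rmult_le_pos; [exact HM4|].
      replace (piece _ _ _ _ _ _) with (P3 (x + t * (y - x))); [apply HP3; nra|].
      assert (HH := psum_hermite N a tau x y t Hkle Ht Hgap).
      unfold P3 at 1; rewrite HH; unfold piece, P3, P2; field.
  (* A degenerate cell contributes 0, which is above - 4 / 720. *)
  - subst y; lra. }
assert (Hsum : forall n : nat, M ^ 5 * (P4 (knot 0%nat) - P4 (knot n)) >=
  phi (M ^ 3 * - P2 (knot 0%nat)) - phi (M ^ 3 * - P2 (knot n)) + (5 * M * (knot n - knot 0%nat) - 4 * INR n) / 720).
{ induction n as [|n IH]; [simpl INR; lra|].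
  specialize (Hstep n); rewrite S_INR; lra. }
(* The total length yields 5 M and the N + 1 cells cost 4 M, so M / 720 remains. *)
specialize (Hsum (N + 1)%nat); fold M in Hsum.
assert (K0 : knot 0%nat = 0) by reflexivity.
assert (K1 : knot (N + 1)%nat = 1).
{ unfold knot; destruct (Nat.eqb_spec (N + 1) 0); [lia|].
  destruct (Nat.leb_spec (N + 1) N); [lia|reflexivity]. }
rewrite K0, K1 in Hsum.
(* The bound k >= 1 matters since 0 ^ 0 = 1. *)
assert (Z : forall k, (1 <= k)%nat -> psum a tau N k 1 = 0).
{ intros k Hk; clear - Htau Hk; induction N as [|n IH]; [apply psum_0|].
  rewrite psum_S, IH by (intros; apply Htau; lia).
  rewrite ppart_le, pow_i by (try lia; specialize (Htau (S n) ltac:(lia)); lra); ring. }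
replace (P2 0) with 0 in Hsum by (unfold P2; lra).
replace (P2 1) with 0 in Hsum by (unfold P2; rewrite Z by lia; field).
replace (P4 0) with c in Hsum by (unfold P4; lra).
replace (P4 1) with 0 in Hsum by (unfold P4; rewrite Z by lia; field).
assert (HM5 : 0 < M ^ 5) by now apply pow_lt.
apply (Rmult_le_reg_l (M ^ 5)); [exact HM5|].
replace (M ^ 5 * (1 / (720 * M ^ 4))) with (M / 720) by (field; lra).
lra.
Qed.

(** * Peano kernel of the formula *)

(** Composing with [clamp] turns continuity within [0,1] into continuity on the line. *)
Definition clamp (x : R) : R := Rmax 0 (Rmin 1 x).

Lemma clamp_I01 x : I01 (clamp x).
Proof. unfold clamp, I01, Rmax, Rmin; repeat destruct Rle_dec; lra. Qed.

Lemma clamp_id x : I01 x -> clamp x = x.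
Proof. unfold clamp, I01, Rmax, Rmin; repeat destruct Rle_dec; lra. Qed.

Lemma clamp_lipschitz x y : Rabs (clamp y - clamp x) <= Rabs (y - x).
Proof.
unfold clamp, Rmax, Rmin, Rabs; repeat destruct Rle_dec; repeat destruct Rcase_abs; lra.
Qed.

Lemma continuity_clamp (g : R -> R) :
  (forall x, I01 x -> continue_in g I01 x) -> forall x, continuity_pt (fun x => g (clamp x)) x.
Proof.
intros Hg x eps Heps.
destruct (Hg (clamp x) (clamp_I01 x) eps Heps) as [d [Hd Hd']].
exists d; split; [exact Hd|]; intros y [_ Hy]; simpl in *; unfold Rdist in *.
destruct (Req_dec (clamp x) (clamp y)) as [<-|Hne].
- rewrite Rminus_diag, Rabs_R0; lra.
- apply Hd'; split; [split; [apply clamp_I01|exact Hne]|].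
  eapply Rle_lt_trans; [apply clamp_lipschitz|exact Hy].
Qed.

Lemma is_derive_clamp (f h : R -> R) x :
  0 < x < 1 -> D_in f h I01 x -> is_derive (fun x => f (clamp x)) x (h x).
Proof.
intros Hx Hf; apply is_derive_Reals; intros eps Heps.
destruct (Hf eps Heps) as [d [Hd Hd']].
assert (Hm : 0 < Rmin d (Rmin x (1 - x))) by (repeat apply Rmin_glb_lt; lra).
exists (mkposreal _ Hm); intros t Ht Htd; simpl in Htd.
pose proof (Rmin_l d (Rmin x (1 - x))); pose proof (Rmin_r d (Rmin x (1 - x))).
pose proof (Rmin_l x (1 - x)); pose proof (Rmin_r x (1 - x)).
assert (Htx : - Rmin x (1 - x) < t < Rmin x (1 - x)) by (apply Rabs_lt_between; lra).
rewrite !clamp_id by (unfold I01; lra).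
assert (Hs : D_x I01 x (x + t) /\ Rdist (x + t) x < d).
{ unfold Rdist; split; [split; [unfold I01; lra|lra]|].
  assert (E : x + t - x = t) by lra; rewrite E; lra. }
specialize (Hd' (x + t) Hs); simpl in Hd'; unfold Rdist in Hd'.
assert (E : x + t - x = t) by lra; rewrite E in Hd'; exact Hd'.
Qed.

(** The extension is f 0 plus the integral of H from 0. It agrees with f on [0,1] by the mean value
    theorem, their difference being continuous with zero derivative inside. *)
Lemma D_in_extension (f h H : R -> R) :
  (forall x, I01 x -> D_in f h I01 x) -> (forall x, continuous H x) ->
  (forall x, I01 x -> H x = h x) ->
  exists F : R -> R, (forall x, is_derive F x (H x)) /\ forall x, I01 x -> F x = f x.
Proof.
intros Hf HH HE.
assert (HF : forall x, is_derive (fun x => f 0 + RInt H 0 x) x (H x)).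
{ intros x; rewrite <- (Rplus_0_l (H x)).
  apply (is_derive_plus (fun _ => f 0)); [apply is_derive_Reals, derivable_pt_lim_const|].
  apply (is_derive_RInt H _ 0); [|apply HH].
  exists (mkposreal 1 Rlt_0_1); intros y _.
  apply (RInt_correct H), (ex_RInt_continuous H); intros; apply HH. }
exists (fun x => f 0 + RInt H 0 x); split; [exact HF|].
intros x Hx.
destruct (MVT_gen (fun y => f (clamp y) - (f 0 + RInt H 0 y)) 0 x (fun _ => 0)) as [c [_ Hc]].
- intros y Hy; rewrite Rmin_left, Rmax_right in Hy by apply Hx.
  unfold I01 in Hx.
  assert (HD := is_derive_minus (fun y => f (clamp y)) _ y _ _
    (is_derive_clamp f h y ltac:(lra) (Hf y ltac:(unfold I01; lra))) (HF y)).
  rewrite HE in HD by (unfold I01; lra).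
  assert (E0 : minus (h y) (h y) = 0) by exact (Rplus_opp_r (h y)).
  exact (eq_ind _ (fun l : R => is_derive (fun y => f (clamp y) - (f 0 + RInt H 0 y)) y l) HD 0 E0).
- intros y _; apply continuity_pt_minus.
  + apply continuity_clamp; intros z Hz; eapply cont_deriv, Hf, Hz.
  + apply derivable_continuous_pt; eexists; apply is_derive_Reals, HF.
- rewrite Rmult_0_l, RInt_point, !clamp_id in Hc by (auto; unfold I01; lra).
  unfold zero in Hc; simpl in Hc; lra.
Qed.

Definition tower (F0 F1 F2 F3 F4 : R -> R) : Prop :=
  (forall x, is_derive F0 x (F1 x)) /\ (forall x, is_derive F1 x (F2 x)) /\
  (forall x, is_derive F2 x (F3 x)) /\ (forall x, is_derive F3 x (F4 x)).

Lemma continuous_of_is_derive (F F' : R -> R) x : is_derive F x (F' x) -> continuous F x.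
Proof. intros H; apply (@ex_derive_continuous R_AbsRing R_NormedModule); eexists; exact H. Qed.

(** Integrating four times from [f4 (clamp x)] gives two-sided derivatives everywhere, endpoints
    included. *)
Lemma C4_01_extension f f4 : C4_01 f f4 ->
  exists F0 F1 F2 F3 F4, tower F0 F1 F2 F3 F4 /\ (forall x, continuous F4 x) /\
    (forall x, I01 x -> F0 x = f x) /\ (forall x, I01 x -> F4 x = f4 x).
Proof.
intros [[f1 [D0 [f2 [D1 [f3 [D2 [g [D3 Hg]]]]]]]] Hc].
set (F4 := fun x => f4 (clamp x)).
assert (C4 : forall x, continuous F4 x).
{ intros x; apply continuity_pt_filterlim, continuity_clamp, Hc. }
assert (E4 : forall x, I01 x -> F4 x = g x).
{ intros x Hx; unfold F4; rewrite clamp_id by exact Hx; now apply Hg. }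
destruct (D_in_extension f3 g F4 D3 C4 E4) as [F3 [H3 E3]].
destruct (D_in_extension f2 f3 F3 D2) as [F2 [H2 E2]]; auto.
{ intros x; eapply continuous_of_is_derive, H3. }
destruct (D_in_extension f1 f2 F2 D1) as [F1 [H1 E1]]; auto.
{ intros x; eapply continuous_of_is_derive, H2. }
destruct (D_in_extension f f1 F1 D0) as [F0 [H0 E0]]; auto.
{ intros x; eapply continuous_of_is_derive, H1. }
exists F0, F1, F2, F3, F4.
refine (conj (conj H0 (conj H1 (conj H2 H3))) (conj C4 (conj E0 _))).
intros x Hx; unfold F4; now rewrite clamp_id.
Qed.

(** * Integration by parts against quartic kernel pieces *)

Lemma peano_piece F0 F1 F2 F3 F4 K K1 K2 K3 a b :
  tower F0 F1 F2 F3 F4 -> tower K K1 K2 K3 (fun _ => 1) -> a <= b ->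
  (forall x, a <= x <= b -> 0 <= F4 x) -> (forall x, a <= x <= b -> 0 <= K x) ->
  0 <= RInt F0 a b + (K b * F3 b - K1 b * F2 b + K2 b * F1 b - K3 b * F0 b)
                   - (K a * F3 a - K1 a * F2 a + K2 a * F1 a - K3 a * F0 a).
Proof.
intros [H0 [H1 [H2 H3]]] [G0 [G1 [G2 G3]]] Hab HF HK.
set (W := fun x => RInt F0 a x + (K x * F3 x - K1 x * F2 x + K2 x * F1 x - K3 x * F0 x)).
(* Four integrations by parts in differential form: as K3' = 1, everything in W' cancels except K
   F4. The mean value theorem then gives the sign of W b - W a. *)
assert (HW : forall x, is_derive W x (K x * F4 x)).
{ intros x.
  assert (HI : is_derive (RInt F0 a) x (F0 x)).
  { apply (is_derive_RInt F0 _ a).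
    - exists (mkposreal 1 Rlt_0_1); intros y _.
      apply (RInt_correct F0), (ex_RInt_continuous F0); intros; eapply continuous_of_is_derive, H0.
    - eapply continuous_of_is_derive, H0. }
  apply is_derive_Reals.
  apply is_derive_Reals in HI.
  assert (Q0 := derivable_pt_lim_mult _ _ _ _ _ (proj1 (is_derive_Reals _ _ _) (G0 x)) (proj1 (is_derive_Reals _ _ _) (H3 x))).
  assert (Q1 := derivable_pt_lim_mult _ _ _ _ _ (proj1 (is_derive_Reals _ _ _) (G1 x)) (proj1 (is_derive_Reals _ _ _) (H2 x))).
  assert (Q2 := derivable_pt_lim_mult _ _ _ _ _ (proj1 (is_derive_Reals _ _ _) (G2 x)) (proj1 (is_derive_Reals _ _ _) (H1 x))).
  assert (Q3 := derivable_pt_lim_mult _ _ _ _ _ (proj1 (is_derive_Reals _ _ _) (G3 x)) (proj1 (is_derive_Reals _ _ _) (H0 x))).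
  assert (Q := derivable_pt_lim_plus _ _ _ _ _ HI (derivable_pt_lim_minus _ _ _ _ _ (derivable_pt_lim_plus _ _ _ _ _ (derivable_pt_lim_minus _ _ _ _ _ Q0 Q1) Q2) Q3)).
  match type of Q with derivable_pt_lim _ _ ?l => replace (K x * F4 x) with l by ring end.
  exact Q. }
destruct (MVT_gen W a b (fun x => K x * F4 x)) as [c [Hc HcE]].
- intros x _; apply HW.
- intros x _; apply derivable_continuous_pt; eexists; apply is_derive_Reals, HW.
- rewrite Rmin_left, Rmax_right in Hc by exact Hab.
  assert (E : W a = K a * F3 a - K1 a * F2 a + K2 a * F1 a - K3 a * F0 a).
  { unfold W; rewrite RInt_point; unfold zero; simpl; ring. }
  rewrite <- E; change (0 <= W b - W a); rewrite HcE.
  apply Rmult_le_pos; [|lra]; apply Rmult_le_pos; auto.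
Qed.

Ltac tower_poly := unfold tower; split; [|split; [|split]]; intro; auto_derive; trivial; field.

(** The kernel and its first derivative vanish at both ends, so only F0 and F1 appear there. *)
Lemma trapezoid_bound F0 F1 F2 F3 F4 a b :
  tower F0 F1 F2 F3 F4 -> a <= b -> (forall x, a <= x <= b -> 0 <= F4 x) ->
  (b - a) / 2 * (F0 a + F0 b) - (b - a) ^ 2 / 12 * (F1 b - F1 a) <= RInt F0 a b.
Proof.
intros HF Hab H4.
assert (HK : tower (fun x => (x - a) ^ 2 * (x - b) ^ 2 / 24)
  (fun x => ((x - a) * (x - b) ^ 2 + (x - a) ^ 2 * (x - b)) / 12)
  (fun x => ((x - b) ^ 2 + 4 * (x - a) * (x - b) + (x - a) ^ 2) / 12)
  (fun x => ((x - a) + (x - b)) / 2) (fun _ => 1)) by tower_poly.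
assert (H := peano_piece _ _ _ _ _ _ _ _ _ a b HF HK Hab H4).
cbv beta in H.
assert (Hpos : forall x, a <= x <= b -> 0 <= (x - a) ^ 2 * (x - b) ^ 2 / 24).
{ intros x _; apply Rdiv_le_0_compat; [|lra]; apply Rmult_le_pos; apply pow2_ge_0. }
specialize (H Hpos); lra.
Qed.

(** The kernel starts from x^4 / 24 and gains - w (x - tau)_+^3 / 6 at each node tau of weight w.
    The weights are such that past 3 h / 4 it equals x^2 (x - h)^2 / 24, the kernel of an inner
    cell, which makes a C^2 junction at h. *)
Lemma end_bound F0 F1 F2 F3 F4 h :
  tower F0 F1 F2 F3 F4 -> 0 < h -> (forall x, 0 <= x <= h -> 0 <= F4 x) ->
  - h / 9 * F0 0 + h * F0 (h / 4) - h / 2 * F0 (h / 2) + h / 9 * F0 (3 * h / 4)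
  + h / 2 * F0 h - h ^ 2 / 12 * F1 h <= RInt F0 0 h.
Proof.
intros HF Hh H4.
assert (Hex : forall u v, ex_RInt F0 u v).
{ intros u v; apply (ex_RInt_continuous F0); intros; eapply continuous_of_is_derive, (proj1 HF). }
assert (HI : RInt F0 0 h = RInt F0 0 (h / 4) + RInt F0 (h / 4) (h / 2)
   + RInt F0 (h / 2) (3 * h / 4) + RInt F0 (3 * h / 4) h).
{ rewrite <- (RInt_Chasles F0 0 (3 * h / 4) h), <- (RInt_Chasles F0 0 (h / 2) (3 * h / 4)),
    <- (RInt_Chasles F0 0 (h / 4) (h / 2)) by auto; reflexivity. }
(* Each of c1, c2, c3 is 0 before its knot and minus the weight of that knot after it. *)
assert (T : forall c1 c2 c3, tower
  (fun x => x ^ 4 / 24 + h * x ^ 3 / 54 + c1 * (x - h / 4) ^ 3 / 6 + c2 * (x - h / 2) ^ 3 / 6 + c3 * (x - 3 * h / 4) ^ 3 / 6)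
  (fun x => x ^ 3 / 6 + h * x ^ 2 / 18 + c1 * (x - h / 4) ^ 2 / 2 + c2 * (x - h / 2) ^ 2 / 2 + c3 * (x - 3 * h / 4) ^ 2 / 2)
  (fun x => x ^ 2 / 2 + h * x / 9 + c1 * (x - h / 4) + c2 * (x - h / 2) + c3 * (x - 3 * h / 4))
  (fun x => x + h / 9 + c1 + c2 + c3) (fun _ => 1)) by (intros; tower_poly).
assert (A1 := peano_piece _ _ _ _ _ _ _ _ _ 0 (h / 4) HF (T 0 0 0) ltac:(lra)
  ltac:(intros; apply H4; lra)).
assert (A2 := peano_piece _ _ _ _ _ _ _ _ _ (h / 4) (h / 2) HF (T (- h) 0 0) ltac:(lra)
  ltac:(intros; apply H4; lra)).
assert (A3 := peano_piece _ _ _ _ _ _ _ _ _ (h / 2) (3 * h / 4) HF (T (- h) (h / 2) 0) ltac:(lra)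
  ltac:(intros; apply H4; lra)).
assert (A4 := peano_piece _ _ _ _ _ _ _ _ _ (3 * h / 4) h HF (T (- h) (h / 2) (- h / 9)) ltac:(lra)
  ltac:(intros; apply H4; lra)).
cbv beta in A1, A2, A3, A4.
match type of A1 with ?P -> _ => assert (B1 : P) end.
{ intros x Hx; replace (_ + _) with (x ^ 4 / 24 + h * x ^ 3 / 54) by field.
  assert (0 <= x ^ 3) by (apply pow_le; lra); assert (0 <= x ^ 4) by (apply pow_le; lra).
  assert (0 <= h * x ^ 3) by (apply Rmult_le_pos; lra); lra. }
match type of A2 with ?P -> _ => assert (B2 : P) end.
(* In the variables y, z >= 0 with y + z = h / 4 the quartic has only nonnegative coefficients. *)
{ intros x Hx; pose (y := x - h / 4); assert (Hy : 0 <= y <= h / 4) by (unfold y; lra).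
  replace x with (h / 4 + y) by (unfold y; ring); clearbody y.
  pose (z := h / 4 - y); assert (Hz : 0 <= z) by (unfold z; lra).
  replace h with (4 * (y + z)) by (unfold z; field); destruct Hy as [Hy _]; clearbody z.
  poly_nonneg. }
match type of A3 with ?P -> _ => assert (B3 : P) end.
{ intros x Hx; pose (y := x - h / 2); assert (Hy : 0 <= y <= h / 4) by (unfold y; lra).
  replace x with (h / 2 + y) by (unfold y; ring); clearbody y.
  pose (z := h / 4 - y); assert (Hz : 0 <= z) by (unfold z; lra).
  replace h with (4 * (y + z)) by (unfold z; field); destruct Hy as [Hy _]; clearbody z.
  poly_nonneg. }
match type of A4 with ?P -> _ => assert (B4 : P) end.
{ intros x Hx; replace (_ + _) with ((x * (x - h)) ^ 2 / 24) by field.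
  apply Rdiv_le_0_compat; [apply pow2_ge_0|lra]. }
specialize (A1 B1); specialize (A2 B2); specialize (A3 B3); specialize (A4 B4).
rewrite HI; lra.
Qed.

Lemma tower_mirror F0 F1 F2 F3 F4 : tower F0 F1 F2 F3 F4 ->
  tower (fun x => F0 (1 - x)) (fun x => - F1 (1 - x)) (fun x => F2 (1 - x))
        (fun x => - F3 (1 - x)) (fun x => F4 (1 - x)).
Proof.
assert (Hm : forall (f f' : R -> R), (forall x, is_derive f x (f' x)) ->
  forall x, is_derive (fun x => f (1 - x)) x (- f' (1 - x))).
{ intros f f' H x.
  replace (- f' (1 - x)) with (scal (-1) (f' (1 - x))) by (unfold scal; simpl; unfold mult; simpl; ring).
  apply (is_derive_comp f (fun x => 1 - x)); [apply H|auto_derive; trivial; ring]. }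
assert (Ho : forall (f f' : R -> R), (forall x, is_derive f x (f' x)) ->
  forall x, is_derive (fun x => - f (1 - x)) x (f' (1 - x))).
{ intros f f' H x; rewrite <- (Ropp_involutive (f' (1 - x))).
  apply (is_derive_opp (fun x => f (1 - x))), Hm, H. }
intros [H0 [H1 [H2 H3]]]; split; [|split; [|split]]; auto.
Qed.

Lemma ex_RInt_tower F0 F1 F2 F3 F4 a b : tower F0 F1 F2 F3 F4 -> ex_RInt F0 a b.
Proof.
intros [H0 _]; apply (ex_RInt_continuous F0); intros; eapply continuous_of_is_derive, H0.
Qed.

Lemma end_bound_mirror F0 F1 F2 F3 F4 h :
  tower F0 F1 F2 F3 F4 -> 0 < h -> (forall x, 1 - h <= x <= 1 -> 0 <= F4 x) ->
  - h / 9 * F0 1 + h * F0 (1 - h / 4) - h / 2 * F0 (1 - h / 2) + h / 9 * F0 (1 - 3 * h / 4)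
  + h / 2 * F0 (1 - h) + h ^ 2 / 12 * F1 (1 - h) <= RInt F0 (1 - h) 1.
Proof.
intros HF Hh H4.
assert (H := end_bound _ _ _ _ _ h (tower_mirror _ _ _ _ _ HF) Hh ltac:(intros; apply H4; lra)).
cbv beta in H; rewrite Rminus_0_r in H.
assert (E : RInt (fun x => F0 (1 - x)) 0 h = RInt F0 (1 - h) 1).
{ assert (HC := is_RInt_comp_lin F0 (-1) 1 0 h (RInt F0 1 (1 - h))).
  replace (-1 * 0 + 1) with 1 in HC by ring; replace (-1 * h + 1) with (1 - h) in HC by ring.
  specialize (HC (RInt_correct _ _ _ (ex_RInt_tower _ _ _ _ _ _ _ HF))).
  apply is_RInt_opp in HC.
  apply (@is_RInt_unique R_CompleteNormedModule) in HC.
  refine (eq_trans (eq_trans _ HC) (opp_RInt_swap F0 1 (1 - h) (ex_RInt_tower _ _ _ _ _ _ _ HF))).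
  apply RInt_ext; intros x _.
  unfold opp, scal; simpl; unfold mult; simpl.
  replace (-1 * x + 1) with (1 - x) by ring; ring. }
rewrite E in H; lra.
Qed.

(** The slope terms telescope, and the two extreme nodes keep half weight, to be completed by the
    end cells. *)
Lemma composite_trapezoid_bound F0 F1 F2 F3 F4 n m :
  tower F0 F1 F2 F3 F4 -> (forall x, 0 <= x <= 1 -> 0 <= F4 x) ->
  (1 <= n)%nat -> (1 <= m <= n)%nat ->
  1 / INR n * sum_n_m (fun k => F0 (INR k / INR n)) 1 m
  - 1 / (2 * INR n) * (F0 (1 / INR n) + F0 (INR m / INR n))
  - 1 / (12 * INR n ^ 2) * (F1 (INR m / INR n) - F1 (1 / INR n))
  <= RInt F0 (1 / INR n) (INR m / INR n).
Proof.
intros HF H4 Hn; assert (Hn0 : 0 < INR n) by (apply lt_0_INR; lia).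
induction m as [|m IH]; [lia|].
intros Hm; destruct (Nat.eq_dec m 0) as [->|Hm0].
- rewrite sum_n_n; simpl (INR 1); rewrite RInt_point; unfold zero; simpl.
  apply Req_le; field; lra.
- specialize (IH ltac:(lia)).
  rewrite sum_n_Sm by lia.
  rewrite <- (RInt_Chasles F0 (1 / INR n) (INR m / INR n)) by (eapply ex_RInt_tower, HF).
  unfold plus; simpl (AbelianMonoid.plus _ _ _ _).
  assert (Hm1 : 0 <= INR m / INR n) by (apply Rdiv_le_0_compat; [apply pos_INR|lra]).
  assert (Hm2 : INR (S m) / INR n <= 1) by (apply Rle_div_l; [lra|rewrite Rmult_1_l; apply le_INR; lia]).
  assert (Hd : INR (S m) / INR n - INR m / INR n = 1 / INR n) by (rewrite S_INR; field; lra).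
  assert (Hd0 : 0 < 1 / INR n) by (apply Rdiv_lt_0_compat; lra).
  assert (HT := trapezoid_bound _ _ _ _ _ (INR m / INR n) (INR (S m) / INR n) HF ltac:(lra)
     ltac:(intros; apply H4; lra)).
  rewrite Hd in HT.
  replace (1 / INR n / 2) with (1 / (2 * INR n)) in HT by (field; lra).
  replace ((1 / INR n) ^ 2 / 12) with (1 / (12 * INR n ^ 2)) in HT by (field; lra).
  assert (Hh : 1 / INR n = 2 * (1 / (2 * INR n))) by (field; lra).
  match goal with |- ?l <= ?r => change (l <= RInt F0 (1 / INR n) (INR m / INR n) + RInt F0 (INR m / INR n) (INR (S m) / INR n)) end.
  match goal with |- ?p * ?s - _ - _ <= _ => 
    change s with (sum_n_m (fun k => F0 (INR k / INR n)) 1 m + F0 (INR (S m) / INR n)) end.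
  set (hh := 1 / (2 * INR n)) in *.
  rewrite Rmult_plus_distr_l; rewrite Hh at 2.
  lra.
Qed.

(** On adding the end cells to the inner range, the F1 terms at h and 1 - h cancel and the half
    weights there add up to h. *)
Lemma Qform_remainder_nonneg F0 F1 F2 F3 F4 n :
  tower F0 F1 F2 F3 F4 -> (forall x, 0 <= x <= 1 -> 0 <= F4 x) -> (2 <= n)%nat ->
  0 <= remainder (Qform n) F0.
Proof.
intros HF H4 Hn.
assert (Hn2 : 2 <= INR n) by (apply (le_INR 2); exact Hn).
set (h := 1 / INR n).
assert (Hh : 0 < h) by (apply Rdiv_lt_0_compat; lra).
assert (Hh2 : h <= 1 / 2) by (unfold h; apply Rle_div_l; lra).
assert (HL := end_bound _ _ _ _ _ h HF Hh ltac:(intros; apply H4; lra)).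
assert (HR := end_bound_mirror _ _ _ _ _ h HF Hh ltac:(intros; apply H4; lra)).
assert (HM := composite_trapezoid_bound _ _ _ _ _ n (n - 1) HF H4 ltac:(lia) ltac:(lia)).
assert (Hl : INR (n - 1) / INR n = 1 - h) by (rewrite minus_INR by lia; unfold h; simpl; field; lra).
rewrite Hl in HM; fold h in HM.
replace (1 / (2 * INR n)) with (h / 2) in HM by (unfold h; field; lra).
replace (1 / (12 * INR n ^ 2)) with (h ^ 2 / 12) in HM by (unfold h; field; lra).
assert (HI : RInt F0 0 1 = RInt F0 0 h + RInt F0 h (1 - h) + RInt F0 (1 - h) 1).
{ rewrite <- (RInt_Chasles F0 0 (1 - h) 1), <- (RInt_Chasles F0 0 h (1 - h))
    by (eapply ex_RInt_tower, HF); reflexivity. }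
unfold remainder, Qform, Defs.sigma; rewrite HI; fold h.
replace (1 / (4 * INR n)) with (h / 4) by (unfold h; field; lra).
replace (1 / (2 * INR n)) with (h / 2) by (unfold h; field; lra).
replace (3 / (4 * INR n)) with (3 * h / 4) by (unfold h; field; lra).
replace (1 / (9 * INR n)) with (h / 9) by (unfold h; field; lra).
rewrite Rminus_0_r.
lra.
Qed.

(** * The error constant of the formula *)

Lemma sum_pow4 m :
  sum_n_m (fun k => INR k ^ 4) 1 m
  = INR m * (INR m + 1) * (2 * INR m + 1) * (3 * INR m ^ 2 + 3 * INR m - 1) / 30 :> R.
Proof.
induction m as [|m IH].
- rewrite sum_n_m_zero by lia; unfold zero; simpl; field.
- rewrite sum_n_Sm by lia.
  change (plus (sum_n_m (fun k => INR k ^ 4) 1 m) (INR (S m) ^ 4))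
    with (sum_n_m (fun k => INR k ^ 4) 1 m + INR (S m) ^ 4).
  rewrite IH, S_INR; field.
Qed.

Lemma Qform_linear n (p q : R) (f g : R -> R) :
  Qform n (fun x => p * f x + q * g x) = p * Qform n f + q * Qform n g.
Proof.
unfold Qform, Defs.sigma.
rewrite (sum_n_m_linear p q (fun k => f (INR k / INR n)) (fun k => g (INR k / INR n))).
unfold Rdiv, Rminus; ring.
Qed.

Lemma Qform_ext n (f g : R -> R) : (2 <= n)%nat ->
  (forall x, I01 x -> f x = g x) -> Qform n f = Qform n g.
Proof.
intros Hn H.
assert (Hn2 : 2 <= INR n) by (apply (le_INR 2); exact Hn).
set (h := 1 / INR n).
assert (Hh : 0 < h) by (apply Rdiv_lt_0_compat; lra).
assert (Hh2 : h <= 1 / 2) by (unfold h; apply Rle_div_l; lra).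
unfold Qform, Defs.sigma; fold h.
replace (1 / (4 * INR n)) with (h / 4) by (unfold h; field; lra).
replace (1 / (2 * INR n)) with (h / 2) by (unfold h; field; lra).
replace (3 / (4 * INR n)) with (3 * h / 4) by (unfold h; field; lra).
rewrite !H by (unfold I01; lra).
do 2 f_equal; apply sum_n_m_ext_loc; intros k Hk; apply H.
split; [apply Rdiv_le_0_compat; [apply pos_INR|lra]|].
apply Rle_div_l; [lra|rewrite Rmult_1_l; apply le_INR; lia].
Qed.

Definition error_const (n : nat) : R := 1 / (720 * INR n ^ 4) * (1 - 15 / (32 * INR n)).

(** As x^4 / 24 has fourth derivative 1, its remainder is the only candidate for the error
    constant. *)
Lemma remainder_pow4 n : (2 <= n)%nat -> remainder (Qform n) (fun x => x ^ 4 / 24) = error_const n.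
Proof.
intros Hn.
assert (Hn2 : 2 <= INR n) by (apply (le_INR 2); exact Hn).
unfold remainder.
rewrite (RInt_ext _ (fun x => 0 + 0 * x + 0 * x ^ 2 / 2 + 0 * x ^ 3 / 6 + 1 * x ^ 4 / 24))
  by (intros; simpl; field).
rewrite (is_RInt_unique _ _ _ _ (is_RInt_poly 0 0 0 0 1)).
unfold Qform, Defs.sigma.
rewrite (sum_n_m_ext _ (fun k => 1 / (24 * INR n ^ 4) * INR k ^ 4 + 0 * INR k ^ 4))
  by (intros; eq_R; field; lra).
rewrite sum_n_m_linear, sum_pow4, minus_INR by lia.
unfold error_const; simpl (INR 1); field; lra.
Qed.

Lemma error_const_pos n : (2 <= n)%nat -> 0 < error_const n.
Proof.
intros Hn.
assert (Hn2 : 2 <= INR n) by (apply (le_INR 2); exact Hn).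
assert (0 < INR n ^ 4) by (apply pow_lt; lra).
apply Rmult_lt_0_compat; [apply Rdiv_lt_0_compat; lra|].
assert (15 / (32 * INR n) < 1) by (apply Rlt_div_l; lra); lra.
Qed.

(** Nonnegativity is applied to F0 - m x^4 / 24, whose fourth derivative is F4 - m. *)
Lemma Qform_remainder_ge F0 F1 F2 F3 F4 n m :
  tower F0 F1 F2 F3 F4 -> (forall x, 0 <= x <= 1 -> m <= F4 x) -> (2 <= n)%nat ->
  m * error_const n <= remainder (Qform n) F0.
Proof.
intros HF H4 Hn.
assert (HT : forall (f f' g g' : R -> R), (forall x, is_derive f x (f' x)) -> (forall x, is_derive g x (g' x)) ->
  forall x, is_derive (fun x => 1 * f x + - m * g x) x (1 * f' x + - m * g' x)).
{ intros f f' g g' Hf Hg x; apply (is_derive_plus (fun x => 1 * f x));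
   [apply (is_derive_scal f)|apply (is_derive_scal g)]; auto. }
assert (HG : tower (fun x => x ^ 4 / 24) (fun x => x ^ 3 / 6) (fun x => x ^ 2 / 2) (fun x => x) (fun _ => 1))
  by tower_poly.
assert (HFG : tower (fun x => 1 * F0 x + - m * (x ^ 4 / 24)) (fun x => 1 * F1 x + - m * (x ^ 3 / 6))
  (fun x => 1 * F2 x + - m * (x ^ 2 / 2)) (fun x => 1 * F3 x + - m * x) (fun x => 1 * F4 x + - m * 1)).
{ destruct HF as [A0 [A1 [A2 A3]]]; destruct HG as [B0 [B1 [B2 B3]]].
  split; [|split; [|split]].
  - now apply (HT _ _ (fun x => x ^ 4 / 24) (fun x => x ^ 3 / 6)).
  - now apply (HT _ _ (fun x => x ^ 3 / 6) (fun x => x ^ 2 / 2)).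
  - now apply (HT _ _ (fun x => x ^ 2 / 2) (fun x => x)).
  - now apply (HT _ _ (fun x => x) (fun _ => 1)). }
assert (H := Qform_remainder_nonneg _ _ _ _ _ n HFG ltac:(intros x Hx; specialize (H4 x Hx); lra) Hn).
rewrite <- (remainder_pow4 n Hn).
unfold remainder in *; rewrite Qform_linear in H.
assert (E : RInt (fun x => 1 * F0 x + - m * (x ^ 4 / 24)) 0 1
  = 1 * RInt F0 0 1 + - m * RInt (fun x => x ^ 4 / 24) 0 1).
{ apply is_RInt_unique.
  apply (is_RInt_plus (fun x => 1 * F0 x) (fun x => - m * (x ^ 4 / 24)));
   [apply (is_RInt_scal F0)|apply (is_RInt_scal (fun x => x ^ 4 / 24))].
  - apply (RInt_correct F0); eapply ex_RInt_tower, HF.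
  - apply (RInt_correct (fun x => x ^ 4 / 24)); eapply ex_RInt_tower, HG. }
rewrite E in H; lra.
Qed.

Lemma tower_opp F0 F1 F2 F3 F4 : tower F0 F1 F2 F3 F4 ->
  tower (fun x => - F0 x) (fun x => - F1 x) (fun x => - F2 x) (fun x => - F3 x) (fun x => - F4 x).
Proof.
intros [H0 [H1 [H2 H3]]]; split; [|split; [|split]]; intros x.
- now apply (is_derive_opp F0).
- now apply (is_derive_opp F1).
- now apply (is_derive_opp F2).
- now apply (is_derive_opp F3).
Qed.

Lemma Qform_remainder_le F0 F1 F2 F3 F4 n M :
  tower F0 F1 F2 F3 F4 -> (forall x, 0 <= x <= 1 -> F4 x <= M) -> (2 <= n)%nat ->
  remainder (Qform n) F0 <= M * error_const n.
Proof.
intros HF H4 Hn.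
assert (H := Qform_remainder_ge _ _ _ _ _ n (- M) (tower_opp _ _ _ _ _ HF)
  ltac:(intros x Hx; specialize (H4 x Hx); lra) Hn).
assert (E : remainder (Qform n) (fun x => - F0 x) = - remainder (Qform n) F0).
{ unfold remainder.
  replace (Qform n (fun x => - F0 x)) with (- Qform n F0).
  - assert (E := RInt_opp F0 0 1 ltac:(eapply ex_RInt_tower, HF)).
    change (RInt (fun x => - F0 x) 0 1 = - RInt F0 0 1) in E; rewrite E; ring.
  - rewrite (Qform_ext n (fun x => - F0 x) (fun x => -1 * F0 x + 0 * F0 x)) by (auto; intros; ring).
    rewrite Qform_linear; ring. }
rewrite E in H; lra.
Qed.

(** The remainder divided by [error_const n] lies between the extrema of F4 on [0,1]; the
    intermediate value theorem supplies xi. *)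
Lemma Qform_error_constant n : (2 <= n)%nat -> is_error_constant4 (Qform n) (error_const n).
Proof.
intros Hn; assert (Hc := error_const_pos n Hn); split; [exact Hc|].
intros f f4 Hf.
destruct (C4_01_extension f f4 Hf) as [F0 [F1 [F2 [F3 [F4 [HF [HC [E0 E4]]]]]]]].
assert (HC' : forall x, continuity_pt F4 x) by (intros; apply continuity_pt_filterlim, HC).
destruct (continuity_ab_min F4 0 1) as [xm [Hm Hxm]]; [lra|auto|].
destruct (continuity_ab_maj F4 0 1) as [xM [HM HxM]]; [lra|auto|].
assert (Hge := Qform_remainder_ge _ _ _ _ _ n (F4 xm) HF Hm Hn).
assert (Hle := Qform_remainder_le _ _ _ _ _ n (F4 xM) HF HM Hn).
assert (HR : remainder (Qform n) f = remainder (Qform n) F0).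
{ unfold remainder; rewrite (Qform_ext n f F0 Hn) by (intros; symmetry; auto).
  f_equal; apply RInt_ext; intros x Hx; rewrite Rmin_left, Rmax_right in Hx by lra.
  symmetry; apply E0; unfold I01; lra. }
destruct (IVT_gen F4 xm xM (remainder (Qform n) F0 / error_const n)) as [xi [Hxi Hv]].
- intros x; auto.
- split.
  + eapply Rle_trans; [apply Rmin_l|]; apply Rle_div_r; lra.
  + eapply Rle_trans; [|apply Rmax_r]; apply Rle_div_l; lra.
- assert (Hxi01 : 0 <= xi <= 1).
  { split.
    - eapply Rle_trans; [|apply Hxi]; apply Rmin_glb; lra.
    - eapply Rle_trans; [apply Hxi|]; apply Rmax_lub; lra. }
  exists xi; split; [exact Hxi01|].
  rewrite HR, <- E4, Hv by exact Hxi01; field; lra.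
Qed.

(** * Asymptotic optimality *)

Lemma error_constant_unique (Q : (R -> R) -> R) c c' :
  is_error_constant4 Q c -> is_error_constant4 Q c' -> c = c'.
Proof.
intros [_ H] [_ H'].
destruct (H _ _ (C4_01_poly 0 0 0 0 1)) as [xi [_ E]].
destruct (H' _ _ (C4_01_poly 0 0 0 0 1)) as [xi' [_ E']].
lra.
Qed.

Lemma c4_eq (Q : (R -> R) -> R) c : is_error_constant4 Q c -> c4 Q = c.
Proof.
intros H; unfold c4.
apply (iota_unique (V := R_CompleteNormedModule)); [|exact H].
intros y Hy; exact (error_constant_unique Q y c Hy H).
Qed.

(** * Nodes and weights in increasing order *)

Definition end_weight (n j : nat) : R :=
  match j with
  | 0%nat => - (1 / (9 * INR n))
  | 1%nat => 1 / INR n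
  | 2%nat => - (1 / (2 * INR n))
  | _ => 1 / (9 * INR n)
  end.

(** Indices 1 to 4 belong to the left end, 5 to n + 3 to the inner nodes k / n with k = i - 4, and n
    + 4 to n + 7 to the right end, counted backwards from 1. *)
Definition Qweight (n i : nat) : R :=
  if (i <=? 4)%nat then end_weight n (i - 1)
  else if (i <=? n + 3)%nat then 1 / INR n
  else end_weight n (n + 7 - i).

Definition Qnode (n i : nat) : R :=
  if (i <=? 4)%nat then (INR i - 1) / (4 * INR n)
  else if (i <=? n + 3)%nat then (INR i - 4) / INR n
  else 1 - (INR n + 7 - INR i) / (4 * INR n).

(** In units of 1 / (4 n) the nodes are piecewise affine in the index, so range and order become
    linear arithmetic. *)
Lemma Qnode_spec n i : (2 <= n)%nat -> exists s, Qnode n i = s / (4 * INR n) /\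
  ((i <= 4)%nat /\ s = INR i - 1 \/
   (5 <= i <= n + 3)%nat /\ s = 4 * INR i - 16 \/
   (n + 4 <= i)%nat /\ s = 3 * INR n + INR i - 7).
Proof.
intros Hn; assert (Hn0 : 0 < INR n) by (apply lt_0_INR; lia).
unfold Qnode; destruct (Nat.leb_spec i 4); [|destruct (Nat.leb_spec i (n + 3))].
- exists (INR i - 1); split; [reflexivity|left; split; [lia|reflexivity]].
- exists (4 * INR i - 16); split; [field; lra|right; left; split; [lia|reflexivity]].
- exists (3 * INR n + INR i - 7); split; [field; lra|right; right; split; [lia|reflexivity]].
Qed.

Lemma Qform_quadrature n : (2 <= n)%nat -> is_quadrature (n + 7) (Qform n).
Proof.
intros Hn; assert (Hn2 : 2 <= INR n) by (apply (le_INR 2); exact Hn).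
exists (Qnode n), (Qweight n); split; [|split].
- intros i [Hi1 Hi2]; destruct (Qnode_spec n i Hn) as [s [-> Hs]].
  apply le_INR in Hi1; apply le_INR in Hi2; rewrite plus_INR in Hi2; simpl in Hi1, Hi2.
  destruct Hs as [[H ->]|[[H ->]|[H ->]]].
  + apply le_INR in H; simpl in H.
    split; [apply Rdiv_le_0_compat; lra|apply Rle_div_l; lra].
  + destruct H as [H H']; apply le_INR in H; apply le_INR in H'; rewrite plus_INR in H'; simpl in H, H'.
    split; [apply Rdiv_le_0_compat; lra|apply Rle_div_l; lra].
  + split; [apply Rdiv_le_0_compat; lra|apply Rle_div_l; lra].
- intros i j Hi Hij Hj.
  destruct (Qnode_spec n i Hn) as [s [-> Hs]]; destruct (Qnode_spec n j Hn) as [r [-> Hr]].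
  apply Rmult_lt_compat_r; [apply Rinv_0_lt_compat; lra|].
  assert (Hij' : INR i + 1 <= INR j) by (rewrite <- S_INR; apply le_INR; lia).
  assert (I3 : INR 3 = 3) by (simpl; ring); assert (I4 : INR 4 = 4) by (simpl; ring).
  assert (I5 : INR 5 = 5) by (simpl; ring).
  destruct Hs as [[H0 ->]|[[H0 ->]|[H0 ->]]]; destruct Hr as [[H1 ->]|[[H1 ->]|[H1 ->]]]; try lia;
   try destruct H0 as [H0 H0']; try destruct H1 as [H1 H1'];
   repeat match goal with h : (_ <= _)%nat |- _ => apply le_INR in h; try rewrite plus_INR in h end;
   lra.
- intros f.
  assert (Hin : sum_n_m (fun i => Qweight n i * f (Qnode n i)) 5 (n + 3)
    = 1 / INR n * sum_n_m (fun k => f (INR k / INR n)) 1 (n - 1)).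
  { replace (n + 3)%nat with (S (S (S (S (n - 1))))) by lia.
    rewrite <- !sum_n_m_S.
    rewrite (sum_n_m_ext_loc _ (fun k => 1 / INR n * f (INR k / INR n) + 0 * f (INR k / INR n))).
    - rewrite sum_n_m_linear, Rmult_0_l, Rplus_0_r; reflexivity.
    - intros k Hk; eq_R.
      unfold Qweight, Qnode.
      destruct (Nat.leb_spec (S (S (S (S k)))) 4); [lia|].
      destruct (Nat.leb_spec (S (S (S (S k)))) (n + 3)); [|lia].
      rewrite !S_INR; replace (INR k + 1 + 1 + 1 + 1 - 4) with (INR k) by ring; ring. }
  assert (Hl : forall i, (i <= 4)%nat -> Qweight n i = end_weight n (i - 1) /\ Qnode n i = (INR i - 1) / (4 * INR n)).
  { intros i Hi; unfold Qweight, Qnode; destruct (Nat.leb_spec i 4); [tauto|lia]. }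
  assert (Hr : forall j, (j <= 3)%nat -> Qweight n (n + 7 - j) = end_weight n j /\
    Qnode n (n + 7 - j) = 1 - INR j / (4 * INR n)).
  { intros j Hj; unfold Qweight, Qnode.
    destruct (Nat.leb_spec (n + 7 - j) 4); [lia|].
    destruct (Nat.leb_spec (n + 7 - j) (n + 3)); [lia|].
    replace (n + 7 - (n + 7 - j))%nat with j by lia.
    rewrite minus_INR, plus_INR by lia; split; [reflexivity|simpl (INR 7); field; lra]. }
  set (u := fun i => Qweight n i * f (Qnode n i)) in *.
  assert (Hs : sum_n_m u 1 (n + 7) = u 1%nat + u 2%nat + u 3%nat + u 4%nat + sum_n_m u 5 (n + 3)
     + u (n + 7 - 3)%nat + u (n + 7 - 2)%nat + u (n + 7 - 1)%nat + u (n + 7 - 0)%nat).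
  { assert (HS : forall m, (1 <= S m)%nat -> sum_n_m u 1 (S m) = sum_n_m u 1 m + u (S m)).
    { intros m Hm; apply (sum_n_Sm u 1 m Hm). }
    assert (HSn : forall m, (m <= n + 3)%nat -> sum_n_m u m (n + 3) = u m + sum_n_m u (S m) (n + 3)).
    { intros m Hm; apply (sum_Sn_m u m (n + 3) Hm). }
    replace (n + 7)%nat with (S (S (S (S (n + 3))))) by lia.
    rewrite !HS, !HSn by lia.
    replace (S (S (S (S (n + 3)))) - 3)%nat with (S (n + 3)) by lia.
    replace (S (S (S (S (n + 3)))) - 2)%nat with (S (S (n + 3))) by lia.
    replace (S (S (S (S (n + 3)))) - 1)%nat with (S (S (S (n + 3)))) by lia.
    replace (S (S (S (S (n + 3)))) - 0)%nat with (S (S (S (S (n + 3))))) by lia.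
    eq_R; ring. }
  rewrite Hs, Hin; unfold u.
  destruct (Hl 1%nat ltac:(lia)) as [-> ->]; destruct (Hl 2%nat ltac:(lia)) as [-> ->].
  destruct (Hl 3%nat ltac:(lia)) as [-> ->]; destruct (Hl 4%nat ltac:(lia)) as [-> ->].
  destruct (Hr 0%nat ltac:(lia)) as [-> ->]; destruct (Hr 1%nat ltac:(lia)) as [-> ->].
  destruct (Hr 2%nat ltac:(lia)) as [-> ->]; destruct (Hr 3%nat ltac:(lia)) as [-> ->].
  unfold Qform, Defs.sigma; simpl (end_weight _ _).
  replace ((INR 1 - 1) / (4 * INR n)) with 0 by (simpl; field; lra).
  replace ((INR 2 - 1) / (4 * INR n)) with (1 / (4 * INR n)) by (simpl; field; lra).
  replace ((INR 3 - 1) / (4 * INR n)) with (1 / (2 * INR n)) by (simpl; field; lra).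
  replace ((INR 4 - 1) / (4 * INR n)) with (3 / (4 * INR n)) by (simpl; field; lra).
  replace (INR 0 / (4 * INR n)) with 0 by (simpl; field; lra).
  replace (INR 1 / (4 * INR n)) with (1 / (4 * INR n)) by (simpl; field; lra).
  replace (INR 2 / (4 * INR n)) with (1 / (2 * INR n)) by (simpl; field; lra).
  replace (INR 3 / (4 * INR n)) with (3 / (4 * INR n)) by (simpl; field; lra).
  eq_R; ring.
Qed.

Lemma c4_plus_bounds n : (2 <= n)%nat ->
  1 / (720 * INR (n + 8) ^ 4) <= c4_plus (n + 7) <= c4 (Qform n).
Proof.
intros Hn; unfold c4_plus.
set (E := fun c => _).
destruct (Glb_Rbar_correct E) as [Hlb Hglb].
assert (HQ : E (c4 (Qform n))).
{ exists (Qform n); split; [now apply Qform_quadrature|split; [|reflexivity]].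
  exists (error_const n); now apply Qform_error_constant. }
assert (Hup : Rbar_le (Glb_Rbar E) (c4 (Qform n))) by exact (Hlb _ HQ).
assert (Hlow : Rbar_le (1 / (720 * INR (n + 8) ^ 4)) (Glb_Rbar E)).
{ apply Hglb; intros c [Q [Hq [[c' Hc'] ->]]]; simpl.
  rewrite (c4_eq Q c' Hc').
  replace (n + 8)%nat with (n + 7 + 1)%nat by lia.
  now apply (error_constant_lower (n + 7) Q). }
(* The two bounds exclude both infinities, so [real] returns the infimum itself. *)
destruct (Glb_Rbar E); simpl in *; tauto.
Qed.

Theorem mainTheorem11 :
  (forall n : nat, (2 <= n)%nat ->
     is_quadrature (n + 7) (Qform n) /\
     positive_definite4 (Qform n) /\
     c4 (Qform n) = 1 / (720 * INR n ^ 4) * (1 - 15 / (32 * INR n))) /\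
  is_lim_seq (fun n : nat => c4 (Qform n) / c4_plus (n + 7)) 1.
Proof.
split.
- intros n Hn; split; [now apply Qform_quadrature|split].
  + exists (error_const n); now apply Qform_error_constant.
  + apply c4_eq; now apply Qform_error_constant.
(* The upper envelope is the quotient of 1 / (720 n^4), which bounds [c4 (Qform n)] from above, by
   the lower bound 1 / (720 (n + 8)^4) of [c4_plus (n + 7)]. *)
- apply is_lim_seq_le_le_loc with (fun _ => 1) (fun n => (1 + 8 * / INR n) ^ 4).
  + exists 2%nat; intros n Hn.
    assert (Hn2 : 2 <= INR n) by (apply (le_INR 2); exact Hn).
    assert (Hb := c4_plus_bounds n Hn).
    assert (Hn8 : INR (n + 8) = INR n + 8) by (rewrite plus_INR; simpl; ring).
    rewrite Hn8 in Hb.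
    assert (HP : 0 < (INR n + 8) ^ 4) by (apply pow_lt; lra).
    assert (HP0 : 0 < INR n ^ 4) by (apply pow_lt; lra).
    assert (Hl : 0 < 1 / (720 * (INR n + 8) ^ 4)) by (apply Rdiv_lt_0_compat; lra).
    split.
    * apply Rle_div_r; lra.
    * apply Rle_div_l; [lra|].
      rewrite (c4_eq _ _ (Qform_error_constant n Hn)).
      assert (HcQ : error_const n <= 1 / (720 * INR n ^ 4)).
      { unfold error_const; rewrite <- (Rmult_1_r (1 / (720 * INR n ^ 4))) at 2.
        apply Rmult_le_compat_l; [apply Rlt_le, Rdiv_lt_0_compat; lra|].
        assert (0 < 15 / (32 * INR n)) by (apply Rdiv_lt_0_compat; lra); lra. }
      eapply Rle_trans; [exact HcQ|].
      replace (1 / (720 * INR n ^ 4)) with ((1 + 8 * / INR n) ^ 4 * (1 / (720 * (INR n + 8) ^ 4)))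
        by (field; lra).
      apply Rmult_le_compat_l; [|apply Hb].
      apply pow_le; assert (0 < / INR n) by (apply Rinv_0_lt_compat; lra); lra.
  + apply is_lim_seq_const.
  + replace (Finite 1) with (Finite ((fun x => (1 + 8 * x) ^ 4) 0)) by (f_equal; ring).
    apply (is_lim_seq_continuous (fun x => (1 + 8 * x) ^ 4) (fun n => / INR n)).
    * apply derivable_continuous_pt, ex_derive_Reals_0; auto_derive; trivial.
    * apply (is_lim_seq_inv INR p_infty); [apply is_lim_seq_INR|discriminate].
Qed.
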